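(* Assume the joint regression model (M), the regularity conditions (A-1), (A-2), (A-3), and that the following moments are finite: $\mathbb{E}[\|X\|^2]$, $\mathbb{E}[\sup_{\theta\in\Theta}|G_1(X'\theta^q)|]$, $\mathbb{E}[|G_1(Y)|]$, $\mathbb{E}[|a(Y)|]$, $\mathbb{E}[\|X\|\sup_{\theta\in\Theta}|G_2(X'\theta^e)|]$, $\mathbb{E}[\sup_{\theta\in\Theta}|G_2(X'\theta^e)|\,\mathbb{E}[|Y|\mid X]]$, $\mathbb{E}[\sup_{\theta\in\Theta}|\mathcal G_2(X'\theta^e)|]$. Then for every sequence $\hat\theta_{\rho,n}\in\Theta$ such that $\frac1n\sum_{i=1}^n\rho(Y_i,X_i,\hat\theta_{\rho,n})\le\frac1n\sum_{i=1}^n\rho(Y_i,X_i,\theta_0)+o_P(1)$, it holds that $\hat\theta_{\rho,n}\to\theta_0$ in probability.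
   Context: Fix $\alpha\in(0,1)$ and $k\in\mathbb{N}$. Let $(\Omega,\mathcal F,P)$ be a complete probability space and $Y:\Omega\to\mathbb{R}$, $X:\Omega\to\mathbb{R}^k$ random variables. For a real random variable $Z$ with distribution function $F$, $Q_\alpha(Z)=\inf\{z\in\mathbb{R}:F(z)\ge\alpha\}$ and $\mathrm{ES}_\alpha(Z)=\frac1\alpha\int_0^\alpha Q_u(Z)\,\mathrm{d}u$; $Q_\alpha(\cdot\mid X)$ and $\mathrm{ES}_\alpha(\cdot\mid X)$ denote these functionals of the conditional distribution given $X$. $F_{Y|X}$ and $f_{Y|X}$ denote the conditional distribution function and density of $Y$ given $X$. Vectors $\theta\in\mathbb{R}^{2k}$ are written $\theta=(\theta^{q\prime},\theta^{e\prime})'$ with $\theta^q,\theta^e\in\mathbb{R}^k$. $\|\cdot\|$ is the maximum norm on vectors. $G^{(j)}$ denotes the $j$-th derivative of a real function $G$. Model (M): $Y=X'\theta^q_0+u^q$ and $Y=X'\theta^e_0+u^e$ where $Q_\alpha(u^q\mid X)=0$ and $\mathrm{ES}_\alpha(u^e\mid X)=0$; $\theta_0=(\theta_0^{q\prime},\theta_0^{e\prime})'\in\Theta$, where $\Theta\subset\mathbb{R}^{2k}$ is compact with nonempty interior. (A-1): $(Y_i,X_i)$, $i=1,\dots,n$, are iid with the distribution of $(Y,X)$; the conditional distribution $F_{Y|X}$ has finite second moments and is absolutely continuous with density $f_{Y|X}$ that is strictly positive, continuous and bounded in a neighbourhood of $X'\theta^q_0$. (A-2): $\mathbb{E}[XX']$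 is positive definite. (A-3): $G_1$ is twice continuously differentiable, increasing and integrable; $\mathcal G_2$ is three times continuously differentiable with $\mathcal G_2^{(1)}=G_2$, and $G_2$ and $G_2^{(1)}$ are strictly positive; $a$ is integrable. The loss is $\rho(Y,X,\theta)=(\mathbf 1_{\{Y\le X'\theta^q\}}-\alpha)G_1(X'\theta^q)-\mathbf 1_{\{Y\le X'\theta^q\}}G_1(Y)+G_2(X'\theta^e)\big(X'\theta^e-X'\theta^q+\frac{(X'\theta^q-Y)\mathbf 1_{\{Y\le X'\theta^q\}}}{\alpha}\big)-\mathcal G_2(X'\theta^e)+a(Y)$. *)

(* Defs.v *)
From HB Require Import structures.
From mathcomp Require Import all_boot all_order all_algebra.
From mathcomp Require Import all_classical all_reals all_analysis.
Set Implicit Arguments. Unset Strict Implicit. Unset Printing Implicit Defensive.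
Import Order.TTheory GRing.Theory Num.Theory.
Import numFieldNormedType.Exports.
Local Open Scope classical_set_scope.
Local Open Scope ring_scope.

Section Defs.
Context {R : realType}.

Definition dotr {k : nat} (x t : 'rV[R]_k) : R := \sum_(j < k) x 0 j * t 0 j.

Definition thq {k : nat} (th : 'rV[R]_(k + k)) : 'rV[R]_k := lsubmx th.
Definition the {k : nat} (th : 'rV[R]_(k + k)) : 'rV[R]_k := rsubmx th.

(* R^k vectors as k-tuples, to use the product (Borel) sigma-algebra *)
Definition rv2t {k : nat} (x : 'rV[R]_k) : k.-tuple R := [tuple x 0 j | j < k].
Definition yx2t {k : nat} (y : R) (x : 'rV[R]_k) : k.+1.-tuple R :=
  [tuple (if unlift ord0 j is Some j' then x 0 j' else y) | j < k.+1].

Definition dfun (mu : probability R R) (z : R) : R := fine (mu `]-oo, z]%classic).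
Definition quantile (a : R) (mu : probability R R) : R :=
  inf [set z | a <= dfun mu z].
Definition ES (a : R) (mu : probability R R) : \bar R :=
  let I : set R := `]0, a]%classic in
  ((a^-1)%:E * \int[lebesgue_measure]_(u in I) (quantile u mu)%:E)%E.

Definition sigmaX {d} {Omega : measurableType d} {k : nat} (X : Omega -> 'rV[R]_k)
  (E : set Omega) : Prop :=
  exists A : set (k.-tuple R), measurable A /\ E = (rv2t \o X) @^-1` A.

Definition is_cond_law {d} {Omega : measurableType d} (P : probability Omega R)
  {k : nat} (X : Omega -> 'rV[R]_k) (Z : Omega -> R)
  (K : 'rV[R]_k -> probability R R) : Prop :=
  (forall B : set R, measurable B ->
     forall A : set R, measurable A ->
       sigmaX X ((fun w => fine (K (X w) B)) @^-1` A)) /\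
  (forall B : set R, measurable B -> forall E, sigmaX X E ->
     P (E `&` Z @^-1` B) = (\int[P]_(w in E) K (X w) B)%E).

Definition iid_as {d} {Omega : measurableType d} (P : probability Omega R)
  {k : nat} (Ys : nat -> Omega -> R) (Xs : nat -> Omega -> 'rV[R]_k)
  (Y : Omega -> R) (X : Omega -> 'rV[R]_k) : Prop :=
  (forall i (A : set (k.+1.-tuple R)), measurable A ->
     P ((fun w => yx2t (Ys i w) (Xs i w)) @^-1` A) =
     P ((fun w => yx2t (Y w) (X w)) @^-1` A)) /\
  (forall (s : seq nat) (A : nat -> set (k.+1.-tuple R)), uniq s ->
     (forall i, measurable (A i)) ->
     P (\big[setI/setT]_(i <- s) ((fun w => yx2t (Ys i w) (Xs i w)) @^-1` A i)) =
     (\prod_(i <- s) P ((fun w => yx2t (Ys i w) (Xs i w)) @^-1` A i))%E).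

Definition outer_prob {d} {Omega : measurableType d} (P : probability Omega R)
  (A : set Omega) : \bar R :=
  ereal_inf [set P B | B in [set B | measurable B /\ A `<=` B]].

Definition Cn (n : nat) (f : R -> R) : Prop :=
  (forall m, (m < n)%N -> forall x, derivable (derive1n m f) x 1) /\
  continuous (derive1n n f).

Definition supTheta {k : nat} (Theta : set 'rV[R]_(k + k)) (g : 'rV[R]_(k + k) -> R) : R :=
  sup (g @` Theta).

Definition rho_loss {k : nat} (alpha : R) (G1 G2 calG2 a : R -> R)
  (y : R) (x : 'rV[R]_k) (th : 'rV[R]_(k + k)) : R :=
  let v := dotr x (thq th) in
  let e := dotr x (the th) in
  let ind : R := if y <= v then 1 else 0 in
  (ind - alpha) * G1 v - ind * G1 y
  + G2 e * (e - v + (v - y) * ind / alpha) - calG2 e + a y.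

End Defs.

(* Main.v *)
(** The loss minus a term free of the parameter is continuous in the parameter, so
    Wald's argument applies: around every [th <> theta0] in [Theta] the infimum of
    [rho(.,th') - rho(.,theta0)] over a small ball is a measurable minorant which, by
    dominated convergence, still has positive mean as soon as
    [E[rho(Y,X,th)] > E[rho(Y,X,theta0)]]; finitely many such balls cover [Theta] away
    from [theta0], and the weak law of large numbers for the minorants concludes.

    The strict inequality comes from a pointwise lower bound of the loss difference by
    [xi1 (1{Y <= q} - alpha) + xi2 (e0 - q + (q - Y)^+ / alpha) + C + D], where [q] and
    [e0] are the conditional quantile and expected shortfall, [xi1] and [xi2] are
    functions of [X], and [C], [D] are nonnegative.  The first two terms have conditional
    mean zero; [C = 0] forces [X'th^e = e0] by strict convexity of [calG2], and
    [D = 0] forces [X'th^q = q] because the conditional density is positive near [q]. *)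
Require Import Defs.
From HB Require Import structures.
From mathcomp Require Import all_boot all_order all_algebra.
From mathcomp Require Import all_classical all_reals all_analysis.
From mathcomp Require Import measurable_realfun ring lra.
Import Order.TTheory GRing.Theory Num.Theory.
Import numFieldNormedType.Exports.
Local Open Scope classical_set_scope.
Local Open Scope ring_scope.
Set Implicit Arguments. Unset Strict Implicit. Unset Printing Implicit Defensive.

Import HBSimple.

(** The laws of [Y] and of the two residuals given [X] come as three unrelated kernels. Uniqueness
    of disintegrations identifies the residual laws, off a null set, with translates of the law of
    [Y]; only then do the model equations speak about the conditional quantile and expected
    shortfall of [Y]. Expected shortfall is an integral of quantiles whereas the loss sees the mean
    of (q - Y)^+; transporting the uniform law by the quantile function ties the two together. With
    v = X'th^q and e = X'th^e, the coefficients are xi1 = G1(v) - G1(q) + G2(e)(v - q)/alpha and xi2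
    = G2(e) - G2(e0); C is a Bregman divergence of calG2, and D is G2(e)/alpha times the convexity
    gap of the positive part between q and v. Vanishing of C and D only says that X'th and X'theta0
    agree almost surely, in both halves; positive definiteness of E[XX'] turns this into th =
    theta0. Estimators carry no measurability, so their events are bounded through the subadditivity
    of outer probability. *)

Lemma eq_ler (R : numDomainType) (x y : R) : x = y -> x <= y.
Proof. by move=> ->. Qed.

(** * Weak law of large numbers *)

Section RealIntegrable.
Context {d} {T : measurableType d} {R : realType}.
Variable P : probability T R.
Implicit Types f g : T -> R.

Definition rintegrable f := P.-integrable setT (EFin \o f).

Lemma rintegrable_cst c : rintegrable (fun=> c).
Proof. exact: finite_measure_integrable_cst. Qed.

Lemma prob_Rintegral_cst c : \int[P]_w c = c.
Proof.
rewrite Rintegral_cst// -[RHS]mulr1; congr (_ * _).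
by rewrite -[RHS]/(fine 1%E); congr fine; exact: probability_setT.
Qed.

Lemma rintegrableD f g : rintegrable f -> rintegrable g ->
  rintegrable (fun w => f w + g w).
Proof. by move=> hf hg; apply: (integrableD _ hf hg). Qed.

Lemma rintegrableB f g : rintegrable f -> rintegrable g ->
  rintegrable (fun w => f w - g w).
Proof. by move=> hf hg; apply: (integrableB _ hf hg). Qed.

Lemma rintegrableZ c f : rintegrable f -> rintegrable (fun w => c * f w).
Proof. by move=> hf; apply: (@integrableZl _ _ _ _ _ _ _ _ hf). Qed.

Lemma rintegrable_norm f : rintegrable f -> rintegrable (fun w => `|f w|).
Proof. by move=> hf; apply: (integrable_abse hf). Qed.

Lemma rintegrable_le f g : measurable_fun setT f -> rintegrable g ->
  (forall w, `|f w| <= g w) -> rintegrable f.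
Proof.
move=> mf hg fg; apply: le_integrable hg => //; first exact/measurable_EFinP.
move=> w _ /=; rewrite lee_fin (le_trans (fg w))// ler_norm//.
Qed.

Lemma rintegrable_sum (I : Type) (s : seq I) (h : I -> T -> R) :
  (forall i, rintegrable (h i)) -> rintegrable (fun w => \sum_(i <- s) h i w).
Proof.
move=> hh; elim: s => [|i s ih].
  by under eq_fun do rewrite big_nil; exact: rintegrable_cst.
by under eq_fun do rewrite big_cons; apply: rintegrableD.
Qed.

Lemma Rintegral_sum (I : Type) (s : seq I) (h : I -> T -> R) :
  (forall i, rintegrable (h i)) ->
  \int[P]_w (\sum_(i <- s) h i w) = \sum_(i <- s) \int[P]_w h i w.
Proof.
move=> hh; elim: s => [|i s ih].
  under eq_Rintegral do rewrite big_nil.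
  by rewrite prob_Rintegral_cst big_nil.
under eq_Rintegral do rewrite big_cons.
rewrite RintegralD//; [|exact: hh|exact: rintegrable_sum].
by rewrite ih big_cons.
Qed.

Lemma rintegrable_indic (A : set T) : measurable A -> rintegrable \1_A.
Proof. exact: integrable_indic. Qed.

Lemma Rintegral_indic (A : set T) : measurable A ->
  \int[P]_w \1_A w = fine (P A).
Proof. by move=> mA; rewrite /Rintegral integral_indic// setIT. Qed.

Lemma RintegralE f : rintegrable f ->
  (\int[P]_w (f w)%:E)%E = (\int[P]_w f w)%:E.
Proof. by move=> hf; rewrite /Rintegral fineK//; exact: integrable_fin_num. Qed.

End RealIntegrable.

Section WeakLaw.
Context {d} {T : measurableType d} {R : realType} (P : probability T R).
Context {d'} {S : measurableType d'} (Zs : nat -> T -> S) (Z : T -> S).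
Hypothesis mZs : forall i, measurable_fun setT (Zs i).
Hypothesis mZ : measurable_fun setT Z.
Hypothesis same_law : forall i (A : set S), measurable A ->
  P (Zs i @^-1` A) = P (Z @^-1` A).
Hypothesis pairwise_indep : forall i j (A B : set S), i != j ->
  measurable A -> measurable B ->
  P (Zs i @^-1` A `&` Zs j @^-1` B) = (P (Zs i @^-1` A) * P (Zs j @^-1` B))%E.

Let avg n (g : S -> R) w := (\sum_(i < n) g (Zs i w)) / n%:R.
Let mean (g : S -> R) := \int[P]_w g (Z w).
Let intg (g : S -> R) := rintegrable P (g \o Z).

(** Both sides are integrals against a push-forward law on [S], and [same_law] makes the two laws
    equal. *)
Lemma same_law_ge0_integral i (g : S -> \bar R) : measurable_fun setT g ->
  (forall z, 0 <= g z)%E -> (\int[P]_w g (Zs i w) = \int[P]_w g (Z w))%E.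
Proof.
move=> mg g0.
have := @ge0_integral_pushforward _ _ _ _ R _ (mZs i) P setT g measurableT.
rewrite preimage_setT => <- //.
have := @ge0_integral_pushforward _ _ _ _ R _ mZ P setT g measurableT.
rewrite preimage_setT => <- //.
by apply: eq_measure_integral => A mA _; exact: same_law.
Qed.

Lemma same_law_integrable i (g : S -> R) : measurable_fun setT g ->
  intg g -> rintegrable P (g \o Zs i).
Proof.
move=> mg /integrableP[_ h]; apply/integrableP; split.
  by apply/measurable_EFinP; exact: measurableT_comp.
rewrite (@same_law_ge0_integral i (fun z => `|(g z)%:E|)%E)//.
by apply: measurableT_comp => //; exact/measurable_EFinP.
Qed.

Lemma rintegrable_avg n (g : S -> R) : measurable_fun setT g ->
  intg g -> rintegrable P (avg n g).
Proof.
move=> mg ig; rewrite /avg; under eq_fun do rewrite mulrC.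
by apply: rintegrableZ; apply: rintegrable_sum => i; exact: same_law_integrable.
Qed.

Lemma same_law_norm i (g : S -> R) : measurable_fun setT g ->
  \int[P]_w `|g (Zs i w)| = \int[P]_w `|g (Z w)|.
Proof.
move=> mg; rewrite /Rintegral; congr fine.
by apply: (@same_law_ge0_integral i (fun z => (`|g z|)%:E));
  first exact/measurable_EFinP/measurableT_comp.
Qed.

(** Averaging contracts L1, uniformly in [n]: the triangle inequality leaves an average of equal
    terms. The uniformity is what lets an L1 approximation pass through the average. *)
Lemma avg_norm_le n (g : S -> R) : measurable_fun setT g -> intg g ->
  \int[P]_w `|avg n g w| <= \int[P]_w `|g (Z w)|.
Proof.
move=> mg ig.
have ign i := rintegrable_norm (same_law_integrable i mg ig).
have [->|n0] := posnP n.
  rewrite /avg; under eq_Rintegral do rewrite big_ord0 mul0r normr0.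
  by rewrite prob_Rintegral_cst; apply: Rintegral_ge0.
apply: (@le_trans _ _ (\int[P]_w (n%:R^-1 * \sum_(i < n) `|g (Zs i w)|))).
  apply: le_Rintegral => //.
  - exact/rintegrable_norm/rintegrable_avg.
  - apply: rintegrableZ; apply: rintegrable_sum => i; exact: ign.
  - move=> w _; rewrite /avg normrM [X in _ * X]ger0_norm ?invr_ge0// mulrC.
    by rewrite ler_pM2l ?invr_gt0 ?ltr0n//; exact: ler_norm_sum.
rewrite RintegralZl//; last by apply: rintegrable_sum => i; exact: ign.
rewrite Rintegral_sum//; last by move=> i; exact: ign.
under eq_bigr do rewrite same_law_norm//.
by rewrite sumr_const card_ord -[X in _ * X]mulr_natl mulrA mulVf ?mul1r// pnatr_eq0 -lt0n.
Qed.

(* Convergence in L1 makes the set of good [g] a closed subspace of L1, which reduces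
   the law to indicators. *)
Definition L1_wlln (g : S -> R) := forall e, 0 < e ->
  \forall n \near \oo, \int[P]_w `|avg n g w - mean g| <= e.

Lemma L1_wllnD (g h : S -> R) : measurable_fun setT g -> measurable_fun setT h ->
  intg g -> intg h -> L1_wlln g -> L1_wlln h ->
  L1_wlln (fun z => g z + h z).
Proof.
move=> mg mh ig ih Lg Lh e e0.
have e20 : 0 < e / 2 by rewrite divr_gt0.
near=> n; have gn : \int[P]_w `|avg n g w - mean g| <= e / 2.
  by near: n; exact: Lg.
have hn : \int[P]_w `|avg n h w - mean h| <= e / 2 by near: n; exact: Lh.
have iag : rintegrable P (fun w => `|avg n g w - mean g|).
  by apply/rintegrable_norm/rintegrableB; [exact: rintegrable_avg|exact: rintegrable_cst].
have iah : rintegrable P (fun w => `|avg n h w - mean h|).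
  by apply/rintegrable_norm/rintegrableB; [exact: rintegrable_avg|exact: rintegrable_cst].
rewrite [e]splitr; apply: le_trans (lerD gn hn).
rewrite -RintegralD//; apply: le_Rintegral => //.
- apply/rintegrable_norm/rintegrableB; last exact: rintegrable_cst.
  apply: rintegrable_avg; first exact: measurable_funD.
  exact: (rintegrableD ig ih).
- exact: rintegrableD.
- move=> w _; rewrite {1}/mean RintegralD// -!/(mean _) /avg big_split/= mulrDl.
  by rewrite opprD addrACA ler_normD.
Unshelve. all: by end_near. Qed.

Lemma L1_wllnZ c (g : S -> R) : measurable_fun setT g -> intg g -> L1_wlln g ->
  L1_wlln (fun z => c * g z).
Proof.
move=> mg ig Lg e e0.
(* The summand 1 keeps the divisor positive when [c] is 0. *)
have c0 : 0 < `|c| + 1 by rewrite ltr_wpDl.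
near=> n; have gn : \int[P]_w `|avg n g w - mean g| <= e / (`|c| + 1).
  by near: n; apply: Lg; rewrite divr_gt0.
have iag : rintegrable P (fun w => `|avg n g w - mean g|).
  by apply/rintegrable_norm/rintegrableB; [exact: rintegrable_avg|exact: rintegrable_cst].
have -> : \int[P]_w `|avg n (fun z => c * g z) w - mean (fun z => c * g z)| =
    `|c| * \int[P]_w `|avg n g w - mean g|.
  rewrite -RintegralZl//; apply: eq_Rintegral => w _.
  by rewrite /mean RintegralZl// /avg -mulr_sumr -mulrA -mulrBr normrM.
apply: (@le_trans _ _ ((`|c| + 1) * \int[P]_w `|avg n g w - mean g|)).
  by rewrite ler_wpM2r ?Rintegral_ge0// lerDl.
by rewrite mulrC -ler_pdivlMr.
Unshelve. all: by end_near. Qed.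

(** Three-term estimate: the average of [g - h], the deviation of [h] and the difference of the
    means contribute e / 3 each; the first is bounded for every [n] at once because averaging
    contracts L1. *)
Lemma L1_wlln_closed (g : S -> R) : measurable_fun setT g -> intg g ->
  (forall e, 0 < e -> exists h : S -> R,
     [/\ measurable_fun setT h, intg h, L1_wlln h &
         \int[P]_w `|g (Z w) - h (Z w)| <= e]) -> L1_wlln g.
Proof.
move=> mg ig H e e0; have e30 : 0 < e / 3 by rewrite divr_gt0.
have [h [mh ih Lh gh]] := H _ e30.
near=> n.
have hn : \int[P]_w `|avg n h w - mean h| <= e / 3 by near: n; exact: Lh.
have mgh : measurable_fun setT (fun z => g z - h z) by exact: measurable_funB.
have igh : intg (fun z => g z - h z) by exact: (rintegrableB ig ih).
have ghn := le_trans (@avg_norm_le n _ mgh igh) gh.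
have mm : `|mean h - mean g| <= e / 3.
  rewrite distrC /mean -RintegralB//; apply: le_trans gh.
  exact: le_normr_Rintegral.
have i1 : rintegrable P (fun w => `|avg n (fun z => g z - h z) w|).
  exact/rintegrable_norm/rintegrable_avg.
have i2 : rintegrable P (fun w => `|avg n h w - mean h|).
  by apply/rintegrable_norm/rintegrableB; [exact: rintegrable_avg|exact: rintegrable_cst].
apply: (@le_trans _ _ (\int[P]_w (`|avg n (fun z => g z - h z) w| +
   `|avg n h w - mean h| + `|mean h - mean g|))).
  apply: le_Rintegral => //.
  - by apply/rintegrable_norm/rintegrableB; [exact: rintegrable_avg|exact: rintegrable_cst].
  - by do 2 ?apply: rintegrableD => //; exact: rintegrable_cst.
  - move=> w _; apply: le_trans (lerD (ler_normD _ _) (lexx _)).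
    apply: le_trans (ler_normD _ _).
    by rewrite /avg sumrB mulrBl; apply: eq_ler; congr `|_|; ring.
rewrite RintegralD//; [|exact: rintegrableD|exact: rintegrable_cst].
rewrite RintegralD// prob_Rintegral_cst.
by have := lerD (lerD ghn hn) mm; lra.
Unshelve. all: by end_near. Qed.

(** Second-moment bound: pairwise independence kills the off-diagonal covariances, so the average
    has variance p(1 - p)/n, with [p] the common probability of the event. *)
Lemma L1_wlln_indic (A : set S) : measurable A -> L1_wlln \1_A.
Proof.
move=> mA e e0; pose p := mean \1_A.
pose D i w : R := \1_A (Zs i w) - p.
have mpre i : measurable (Zs i @^-1` A) by rewrite -[X in measurable X]setTI; exact: mZs.
have mpre0 : measurable (Z @^-1` A) by rewrite -[X in measurable X]setTI; exact: mZ.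
have pE : p = fine (P (Z @^-1` A)).
  by rewrite /p /mean -Rintegral_indic//; exact: eq_Rintegral.
have p0 : 0 <= p by rewrite pE fine_ge0.
have p1 : p <= 1 by rewrite pE -[leRHS]/(fine 1%E) fine_le// ?fin_num_measure// probability_le1.
have indE i w : \1_A (Zs i w) = \1_(Zs i @^-1` A) w :> R by [].
have DE i j w : D i w * D j w =
    \1_(Zs i @^-1` A `&` Zs j @^-1` A) w +
    (- p) * \1_(Zs i @^-1` A) w + (- p) * \1_(Zs j @^-1` A) w + p ^+ 2.
  by rewrite /D !indE indicI/=; ring.
have iD i j : rintegrable P (fun w => D i w * D j w).
  under eq_fun do rewrite DE.
  apply: rintegrableD; last exact: rintegrable_cst.
  apply: rintegrableD; last exact/rintegrableZ/rintegrable_indic.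
  apply: rintegrableD; last exact/rintegrableZ/rintegrable_indic.
  exact/rintegrable_indic/measurableI.
have ID i j : \int[P]_w (D i w * D j w) = if i == j then p * (1 - p) else 0.
  under eq_Rintegral do rewrite DE.
  have mij : measurable (Zs i @^-1` A `&` Zs j @^-1` A) by exact: measurableI.
  rewrite RintegralD//; first last.
  - exact: rintegrable_cst.
  - by do 2 ?apply: rintegrableD; do ?apply: rintegrableZ; exact: rintegrable_indic.
  rewrite RintegralD//; first last.
  - exact/rintegrableZ/rintegrable_indic.
  - by apply: rintegrableD; do ?apply: rintegrableZ; exact: rintegrable_indic.
  rewrite RintegralD//; [|exact: rintegrable_indic|exact/rintegrableZ/rintegrable_indic].
  rewrite !RintegralZl//; try exact: rintegrable_indic; try exact: rintegrable_cst.
  rewrite !Rintegral_indic// prob_Rintegral_cst !same_law// -!pE.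
  case: eqP => [<-|/eqP ij].
    by rewrite setIid same_law// -pE; ring.
  by rewrite pairwise_indep// !same_law// fineM ?fin_num_measure// -!pE; ring.
near=> n.
have n0 : (0 < n)%N by near: n; exact: nbhs_infty_gt.
(* This makes 1/n, which bounds the variance, at most [e ^+ 2]. *)
have nne : (e ^+ 2)^-1 <= n%:R by near: n; exact: nbhs_infty_ger.
have nn0 : n%:R != 0 :> R by rewrite pnatr_eq0 -lt0n.
have SE w : (avg n \1_A w - p) ^+ 2 = (n%:R ^+ 2)^-1 * \sum_(i < n) \sum_(j < n) D i w * D j w.
  have -> : avg n \1_A w - p = n%:R^-1 * \sum_(i < n) D i w.
    rewrite /avg /D sumrB mulrBr sumr_const card_ord -[p *+ n]mulr_natl mulrA.
    by rewrite mulVf// mul1r mulrC.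
  rewrite exprMn -exprVn; congr (_ * _); rewrite expr2 mulr_suml.
  by apply: eq_bigr => i _; rewrite mulr_sumr.
have iS : rintegrable P (fun w => (avg n \1_A w - p) ^+ 2).
  under eq_fun do rewrite SE.
  apply: rintegrableZ; apply: rintegrable_sum => i.
  by apply: rintegrable_sum => j.
have IS : \int[P]_w ((avg n \1_A w - p) ^+ 2) <= n%:R^-1.
  under eq_Rintegral do rewrite SE.
  rewrite RintegralZl//; last by apply: rintegrable_sum => i; apply: rintegrable_sum => j.
  rewrite Rintegral_sum//; last by move=> i; apply: rintegrable_sum => j.
  have -> : \sum_(i < n) \int[P]_w (\sum_(j < n) D i w * D j w) = n%:R * (p * (1 - p)).
    transitivity (\sum_(i < n) p * (1 - p)); last first.
      by rewrite sumr_const card_ord mulr_natl.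
    apply: eq_bigr => i _; rewrite Rintegral_sum//.
    rewrite (bigD1 i)//= ID eqxx big1 ?addr0// => j ji.
    by rewrite ID ifF//; apply/eqP => /ord_inj/eqP; rewrite eq_sym (negPf ji).
  have -> : (n%:R ^+ 2)^-1 * (n%:R * (p * (1 - p))) = n%:R^-1 * (p * (1 - p)) by field.
  rewrite ler_piMr ?invr_ge0//.
  by nra.
(* [2 |x| <= e + x^2 / e] trades the square root of the variance for linearity *)
apply: (@le_trans _ _ (\int[P]_w (e / 2 + (2 * e)^-1 * (avg n \1_A w - p) ^+ 2))).
  apply: le_Rintegral => //.
  - apply/rintegrable_norm/rintegrableB; last exact: rintegrable_cst.
    apply: rintegrable_avg; first exact: measurable_indic.
    exact: (@rintegrable_indic _ _ _ P (Z @^-1` A)).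
  - by apply: rintegrableD; [exact: rintegrable_cst|exact: rintegrableZ].
  - move=> w _; rewrite -/p -(@real_normK _ (avg n \1_A w - p)) ?num_real//.
    set x := `|_|; rewrite -subr_ge0.
    have -> : e / 2 + (2 * e)^-1 * x ^+ 2 - x = (x - e) ^+ 2 / (2 * e).
      by field; exact: lt0r_neq0.
    by rewrite divr_ge0 ?sqr_ge0// ltW// mulr_gt0.
rewrite RintegralD//; [|exact: rintegrable_cst|exact: rintegrableZ].
rewrite prob_Rintegral_cst RintegralZl//.
have h : \int[P]_w ((avg n \1_A w - p) ^+ 2) <= e ^+ 2.
  apply: le_trans IS _; rewrite -[leRHS]invrK lef_pV2 ?posrE ?invr_gt0 ?exprn_gt0//.
  by rewrite ltr0n.
rewrite [leRHS]splitr lerD2l mulrC ler_pdivrMr ?mulr_gt0//.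
by apply: le_trans h _; rewrite expr2; apply: eq_ler; field.
Unshelve. all: by end_near. Qed.

(** Simple functions are dense in L1 of the law of [Z], and each is a finite combination of
    indicators of its level sets. The approximation takes place under the push-forward law and is
    pulled back to [P]. *)
Lemma L1_wlln_integrable (g : S -> R) : measurable_fun setT g -> intg g -> L1_wlln g.
Proof.
move=> mg ig; apply: L1_wlln_closed => // e e0.
have ig' : (pushforward P Z).-integrable setT (EFin \o g).
  by apply: integrable_pushforward => //; exact/measurable_EFinP.
have [h_ [ih _ Hh]] := approximation_sfun_integrable measurableT ig'.
have [N _ hN] : \forall n \near \oo,
    (\int[pushforward P Z]_z `|(g z)%:E - (h_ n z)%:E| < e%:E)%E.
  have : nbhs (0%E : \bar R) [set x | (x < e%:E)%E].
    by apply: open_ereal_lt'; rewrite lte_fin.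
  by move=> /Hh.
have {}hN := hN N (leqnn N).
pose h : S -> R := h_ N.
have mh : measurable_fun setT h by [].
have ih' : intg h.
  apply/integrableP; split; first exact/measurable_EFinP/measurableT_comp.
  have /integrableP[_] := ih N.
  rewrite ge0_integral_pushforward//.
  by apply/measurableT_comp => //; exact/measurable_EFinP.
(* An arbitrary list of values permits induction; the list of all values of [h] gives [h] back. *)
pose F (s : seq R) z := \sum_(r <- s) r * \1_(h @^-1` [set r]) z.
have hF s : [/\ measurable_fun setT (F s), intg (F s) & L1_wlln (F s)].
  elim: s => [|r s [ms iF Ls]].
    rewrite /F; under [fun z => _]eq_fun do rewrite big_nil.
    split; [exact: measurable_cst|exact: rintegrable_cst|move=> e' e'0; apply: nearW => n].
    rewrite /avg /mean; under eq_Rintegral do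
      rewrite prob_Rintegral_cst big1// mul0r subrr normr0.
    by rewrite prob_Rintegral_cst ltW.
  rewrite /F; under [fun z => _]eq_fun do rewrite big_cons.
  have mr : measurable (h @^-1` [set r]).
    by rewrite -[X in measurable X]setTI; exact: measurable_funPT.
  have ir : intg (\1_(h @^-1` [set r])).
    apply: (@rintegrable_indic _ _ _ P (Z @^-1` (h @^-1` [set r]))).
    by rewrite -[X in measurable X]setTI; exact: mZ.
  have mr1 : measurable_fun setT (fun z => r * \1_(h @^-1` [set r]) z).
    by apply: measurable_funM => //; exact: measurable_indic.
  split.
  - exact: measurable_funD.
  - by apply: rintegrableD => //; exact: rintegrableZ.
  - apply: L1_wllnD => //; first exact: rintegrableZ.
    by apply: L1_wllnZ => //; exact: L1_wlln_indic.
exists h; split => //.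
  have -> : h = F (finmap.enum_fset (fset_set (range h))).
    by apply/funext => z; rewrite /h fimfunE fsbig_finite.
  by have [] := hF (finmap.enum_fset (fset_set (range h))).
rewrite -lee_fin -RintegralE; last first.
  by apply: rintegrable_norm; exact: rintegrableB.
move/ltW: hN; rewrite ge0_integral_pushforward//.
apply/measurableT_comp => //.
by apply/measurable_EFinP/measurable_funB.
Qed.

Lemma measurable_avg n (g : S -> R) : measurable_fun setT g ->
  measurable_fun setT (avg n g).
Proof.
move=> mg; apply: measurable_funM => //.
apply: (@measurable_sum _ _ _ _ _ _ (fun (i : 'I_n) w => g (Zs i w))) => i.
exact: measurableT_comp.
Qed.

(** Markov's inequality: on this event the average lies at least [mean g - c] below its mean. The
    consistency proof uses the law of large numbers in this one-sided form. *)
Lemma wlln_lower_tail (g : S -> R) c e : measurable_fun setT g -> intg g ->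
  c < mean g -> 0 < e ->
  \forall n \near \oo, (P [set w | ((\sum_(i < n) g (Zs i w)) / n%:R <= c)%R] <= e%:E)%E.
Proof.
move=> mg ig cm e0; have mc0 : 0 < mean g - c by rewrite subr_gt0.
near=> n.
have Hn : \int[P]_w `|avg n g w - mean g| <= (mean g - c) * e.
  by near: n; apply: L1_wlln_integrable => //; rewrite mulr_gt0.
pose A := [set w | avg n g w <= c].
have mA : measurable A.
  rewrite /A -[X in measurable X]setTI.
  by apply: (measurable_fun_ler (measurable_avg n mg) _).
rewrite -[X in P X]/A -[P A]fineK ?fin_num_measure// lee_fin -Rintegral_indic//.
rewrite -(ler_pM2l mc0) -RintegralZl//; last exact: rintegrable_indic.
apply: le_trans Hn; apply: le_Rintegral => //.
- exact/rintegrableZ/rintegrable_indic.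
- by apply/rintegrable_norm/rintegrableB; [exact: rintegrable_avg|exact: rintegrable_cst].
- move=> w _; rewrite indicE; case: (boolP (w \in A)); last by rewrite mulr0.
  rewrite inE /A /= => wA; rewrite mulr1 distrC; apply: le_trans (ler_norm _).
  by rewrite lerB.
Unshelve. all: by end_near. Qed.

End WeakLaw.

(** * Conditional laws *)

Section ProbKernel.
Context {d} {S : measurableType d} {R : realType} (k : S -> probability R R).
Hypothesis mk : forall B, measurable B -> measurable_fun setT (k ^~ B).

Let k' : S -> {measure set R -> \bar R} := k.
HB.instance Definition _ := isKernel.Build _ _ S R R k' mk.
HB.instance Definition _ := Kernel_isProbability.Build _ _ S R R k'
  (fun x => probability_setT (k x)).
Definition prob_kernel : R.-pker S ~> R := k'.

End ProbKernel.

Section Disintegration.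
Local Open Scope ereal_scope.
Context {d} {T : measurableType d} {R : realType} (P : probability T R).
Context {d'} {S : measurableType d'} (p : T -> S) (Z : T -> R).
Variable k : S -> probability R R.
Hypothesis mp : measurable_fun setT p.
Hypothesis mZ : measurable_fun setT Z.
Hypothesis mk : forall B, measurable B -> measurable_fun setT (k ^~ B).
Hypothesis kE : forall A B, measurable A -> measurable B ->
  P (p @^-1` A `&` Z @^-1` B) = \int[P]_(w in p @^-1` A) k (p w) B.

(** The Dirac mass at [s] times [k s], as the push-forward of [k s] along y -> (s, y). The [unit]
    factor makes it composable with [law], a kernel out of the one-point space; the composition is
    the candidate for the joint law of [p] and [Z]. *)
Let pair_kernel (us : unit * S) : {measure set (S * R) -> \bar R} :=
  measure_function_pushforward__canonical__measure_function_Measure (k us.2)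
    (pair1_measurable us.2).

Let pair_kernelE us A : pair_kernel us A = k us.2 (xsection A us.2).
Proof. by rewrite /pair_kernel/= /pushforward xsectionE. Qed.

Let k' := prob_kernel mk.

Let measurable_pair_kernel A : measurable A ->
  measurable_fun setT (pair_kernel ^~ A).
Proof.
move=> mA.
under eq_fun do rewrite pair_kernelE.
apply: (@measurableT_comp _ _ _ _ _ _ (fun s => k s (xsection A s))) => //.
by apply: (measurable_fun_xsection_finite_kernel k'); rewrite inE.
Qed.
HB.instance Definition _ := isKernel.Build _ _ (unit * S)%type (S * R)%type R
  pair_kernel measurable_pair_kernel.
Let pair_kernel1 us : pair_kernel us setT = 1.
Proof. by rewrite pair_kernelE xsectionE preimage_setT probability_setT. Qed.
HB.instance Definition _ := Kernel_isProbability.Build _ _ (unit * S)%type (S * R)%type R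
  pair_kernel pair_kernel1.

Let law : unit -> {measure set S -> \bar R} :=
  fun=> measure_function_pushforward__canonical__measure_function_Measure P mp.
Let measurable_law A : measurable A -> measurable_fun setT (law ^~ A).
Proof. by move=> mA; exact: measurable_cst. Qed.
HB.instance Definition _ := isKernel.Build _ _ unit S R law measurable_law.
Let law1 u : law u setT = 1.
Proof. by rewrite /law/= /pushforward preimage_setT probability_setT. Qed.
HB.instance Definition _ := Kernel_isProbability.Build _ _ unit S R law law1.

(** The joint law of (p, Z) and the composed kernel agree on measurable rectangles by [kE]; these
    form a generating pi-system, so the measures agree and so do their integrals. *)
Lemma ge0_disintegration (f : S * R -> \bar R) : measurable_fun setT f ->
  (forall z, 0 <= f z) ->
  \int[P]_w f (p w, Z w) = \int[P]_w \int[k (p w)]_y f (p w, y).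
Proof.
move=> mf f0.
have mpZ : measurable_fun setT (fun w => (p w, Z w)) by exact: measurable_fun_pair.
have kf x : \int[pair_kernel (tt, x)]_z f z = \int[k x]_y f (x, y).
  rewrite ge0_integral_pushforward//=.
have mkf : measurable_fun setT (fun x => \int[k x]_y f (x, y)).
  exact: (measurable_fun_integral_finite_kernel f k').
transitivity (\int[kcomp law pair_kernel tt]_z f z); last first.
  rewrite integral_kcomp//.
  under eq_integral do rewrite kf.
  rewrite ge0_integral_pushforward//=.
  by move=> x _; exact: integral_ge0.
have := @ge0_integral_pushforward _ _ _ _ R _ mpZ P setT f measurableT.
rewrite preimage_setT => <- //.
apply: eq_measure_integral => A mA _.
pose G : set (set (S * R)) := [set A `*` B | A in measurable & B in measurable].
apply: (measure_unique G (fun=> setT)) => //.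
- by rewrite measurable_prod_measurableType.
- move=> _ _ [A1 mA1 [B1 mB1 <-]] [A2 mA2 [B2 mB2 <-]].
  by rewrite -setXI; exists (A1 `&` A2); [exact: measurableI|exists (B1 `&` B2) => //; exact: measurableI].
- by move=> _; exists setT => //; exists setT => //; rewrite setXTT.
- by rewrite bigcup_const//; exists 0%N.
- move=> _ [A1 mA1 [B1 mB1 <-]].
  transitivity (P (p @^-1` A1 `&` Z @^-1` B1)); first by [].
  have mkAB : measurable_fun setT (fun x => k x (xsection (A1 `*` B1) x)).
    by apply: (measurable_fun_xsection_finite_kernel k'); rewrite inE; exact: measurableX.
  rewrite kE// /= /kcomp; under [RHS]eq_integral do rewrite pair_kernelE.
  rewrite ge0_integral_pushforward//=.
  rewrite preimage_setT integral_mkcond; apply: eq_integral => w _.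
  rewrite patchE; case: ifPn => wA.
    by rewrite in_xsectionX//; rewrite inE in wA *.
  by rewrite notin_xsectionX ?measure0//.
- by move=> _; rewrite /=/pushforward preimage_setT probability_setT ltry.
Qed.

Lemma measurable_kernel_integral (f : S * R -> R) : measurable_fun setT f ->
  measurable_fun setT (fun w => \int[k (p w)]_y (f (p w, y))%:E).
Proof.
move=> mf; pose F := EFin \o f; have mF : measurable_fun setT F by exact/measurable_EFinP.
have mk_ g : measurable_fun setT g -> (forall z, 0 <= g z) ->
    measurable_fun setT (fun w => \int[k (p w)]_y g (p w, y)).
  move=> mg g0.
  have := measurable_fun_integral_finite_kernel g k' g0 mg.
  by move=> /measurableT_comp; apply.
have -> : (fun w => \int[k (p w)]_y (f (p w, y))%:E) = (fun w =>
    \int[k (p w)]_y F^\+ (p w, y) - \int[k (p w)]_y F^\- (p w, y)).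
  apply/funext => w; rewrite integralE; congr (_ - _); apply: eq_integral => y _.
    by rewrite !funeposE.
  by rewrite !funenegE.
by apply: emeasurable_funB; apply: mk_ => //; [exact: measurable_funepos|exact: measurable_funeneg].
Qed.

(** Integrability of [f] along (p, Z) makes the integrals of its positive and negative parts finite,
    so the nonnegative case can be applied to each and the results subtracted. *)
Lemma disintegration (f : S * R -> R) : measurable_fun setT f ->
  P.-integrable setT (fun w => (f (p w, Z w))%:E) ->
  \int[P]_w (f (p w, Z w))%:E = \int[P]_w \int[k (p w)]_y (f (p w, y))%:E.
Proof.
move=> mf /= fi.
pose F := EFin \o f; have mF : measurable_fun setT F by exact/measurable_EFinP.
have mk_ g : measurable_fun setT g -> (forall z, 0 <= g z) ->
    measurable_fun setT (fun w => \int[k (p w)]_y g (p w, y)).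
  move=> mg g0.
  have := measurable_fun_integral_finite_kernel g k' g0 mg.
  by move=> /measurableT_comp; apply.
rewrite integralE.
have Ep : \int[P]_w ((fun w => (f (p w, Z w))%:E)^\+ w) =
    \int[P]_w \int[k (p w)]_y (F^\+ (p w, y)).
  rewrite -(@ge0_disintegration F^\+).
  - by apply: eq_integral => w _; rewrite !funeposE.
  - exact: measurable_funepos.
  - by move=> z; exact: funepos_ge0.
have En : \int[P]_w ((fun w => (f (p w, Z w))%:E)^\- w) =
    \int[P]_w \int[k (p w)]_y (F^\- (p w, y)).
  rewrite -(@ge0_disintegration F^\-).
  - by apply: eq_integral => w _; rewrite !funenegE.
  - exact: measurable_funeneg.
  - by move=> z; exact: funeneg_ge0.
rewrite Ep En -integralB//.
- apply: eq_integral => w _; rewrite [RHS]integralE; congr (_ - _);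
    apply: eq_integral => y _; by rewrite ?funeposE ?funenegE.
- apply/integrableP; split; first exact/mk_/funepos_ge0/measurable_funepos.
  under eq_integral do rewrite gee0_abs ?integral_ge0//.
  rewrite -Ep; have /integrableP[_] := integrable_funepos measurableT fi.
  by under eq_integral do rewrite gee0_abs//.
- apply/integrableP; split; first exact/mk_/funeneg_ge0/measurable_funeneg.
  under eq_integral do rewrite gee0_abs ?integral_ge0//.
  rewrite -En; have /integrableP[_] := integrable_funeneg measurableT fi.
  by under eq_integral do rewrite gee0_abs//.
Qed.

End Disintegration.

(** Rational rays are a countable pi-system generating the Borel sets. Countability is the point: an
    almost sure identity checked ray by ray holds for all Borel sets off one null set. *)
Lemma measure_eq_rat_rays (R : realType) (mu nu : {measure set R -> \bar R}) :
  (mu setT < +oo)%E ->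
  (forall q : rat, mu (`]-oo, ratr q]%classic : set R) = nu (`]-oo, ratr q]%classic : set R)) ->
  forall B, measurable B -> mu B = nu B.
Proof.
move=> mufin h.
pose G : set (set R) := [set A | exists q : rat, A = `]-oo, ratr q]%classic].
have mray (x : R) : measurable (`]-oo, x]%classic : set R) by exact: measurable_itv.
apply: (measure_unique G (fun n => `]-oo, n%:R]%classic : set R)) => //.
- transitivity (<<s @RGenInftyO.G R>>); first exact: RGenInftyO.measurableE.
  apply/seteqP; split.
    apply: smallest_sub; first exact: smallest_sigma_algebra.
    move=> _ [x ->].
    pose F n : set R := if unpickle n is Some q then
      if ratr q < x then `]-oo, ratr q]%classic else set0 else set0.
    have -> : `]-oo, x[%classic = \bigcup_n F n.
      apply/seteqP; split => [y /=|y [n _]].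
        rewrite in_itv/= => yx; have [q] := rat_in_itvoo yx.
        rewrite in_itv/= => /andP[yq qx]; exists (pickle q); first exact: I.
        by rewrite /F pickleK qx /= in_itv/= ltW.
      rewrite /F; case: unpickle => // q; case: ifPn => // qx.
      by rewrite /= !in_itv/= => yq; exact: le_lt_trans qx.
    apply: (sigma_algebra_bigcup) => n; rewrite /F.
    case: unpickle => [q|]; last exact: sigma_algebra0.
    case: ifPn => _; last exact: sigma_algebra0.
    by apply: sub_sigma_algebra; exists q.
  rewrite (_ : <<s @RGenInftyO.G R>> = measurable); last exact/esym/RGenInftyO.measurableE.
  apply: smallest_sub; first exact: sigma_algebra_measurable.
  by move=> _ [q ->]; exact: mray.
- move=> _ _ [q ->] [r ->]; have [qr|rq] := leP q r.
    exists q; apply/seteqP; split => [y [] //|y /= yq].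
    split => //=; move: yq; rewrite !in_itv/= => yq.
    by rewrite (le_trans yq)// ler_rat.
  exists r; apply/seteqP; split => [y [] //|y /= yq].
  split => //=; move: yq; rewrite !in_itv/= => yq.
  by rewrite (le_trans yq)// ler_rat ltW.
- by move=> n; exists n%:R; rewrite ratr_nat.
- apply/seteqP; split => // x _; exists (Num.truncn x).+1; first exact: I.
  by rewrite /= in_itv/= ltW// Num.Theory.truncnS_gt.
- by move=> _ [q ->].
- by move=> n; apply: le_lt_trans mufin; apply: le_measure; rewrite ?inE.
Qed.

(** * Conditional laws of a variable and of its translates *)

Section ShiftedConditionalLaw.
Local Open Scope ereal_scope.
Context {d} {T : measurableType d} {R : realType} (P : probability T R).
Context {d'} {S : measurableType d'} (p : T -> S) (Z : T -> R) (s : S -> R).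
Variables k1 k2 : S -> probability R R.
Hypothesis mp : measurable_fun setT p.
Hypothesis mZ : measurable_fun setT Z.
Hypothesis ms : measurable_fun setT s.
Hypothesis mk1 : forall B, measurable B -> measurable_fun setT (k1 ^~ B).
Hypothesis mk2 : forall B, measurable B -> measurable_fun setT (k2 ^~ B).
Hypothesis kE1 : forall A B, measurable A -> measurable B ->
  P (p @^-1` A `&` Z @^-1` B) = \int[P]_(w in p @^-1` A) k1 (p w) B.
Hypothesis kE2 : forall A B, measurable A -> measurable B ->
  P (p @^-1` A `&` (fun w => Z w - s (p w))%R @^-1` B) =
  \int[P]_(w in p @^-1` A) k2 (p w) B.

Lemma ae_shifted_law : {ae P, forall w, forall B, measurable B ->
  k2 (p w) B = k1 (p w) ((fun y : R => y - s (p w))%R @^-1` B)}.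
Proof.
have msh x : measurable_fun setT (fun y : R => y - s x)%R by exact: measurable_funB.
suff H : {ae P, forall w, forall n : nat, forall q : rat, unpickle n = Some q ->
    k2 (p w) `]-oo, ratr q]%classic = k1 (p w) ((fun y : R => y - s (p w))%R @^-1` `]-oo, ratr q]%classic)}.
  apply: filterS H => w Hw B mB.
  have := @measure_eq_rat_rays R (k2 (p w))
    (measure_function_pushforward__canonical__measure_function_Measure (k1 (p w)) (msh (p w))).
  rewrite /= /pushforward; apply => //; last by move=> q; apply: (Hw (pickle q)); rewrite pickleK.
  by rewrite probability_setT ltry.
(* The rationals are run through by their codes, since almost sure statements are merged over
   natural numbers. *)
apply/ae_foralln => n; case: (unpickle n) => [q|]; last exact: nearW.
pose mu := measure_function_pushforward__canonical__measure_function_Measure P mp.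
pose f x := k2 x `]-oo, ratr q]%classic.
pose g x := k1 x ((fun y : R => y - s x)%R @^-1` `]-oo, ratr q]%classic).
(* The shift depends on the conditioning point, so the event is a subset of the product, and [g] is
   the kernel mass of its sections. *)
pose A : set (S * R) := [set z | (z.2 - s z.1 <= ratr q)%R].
have mA : measurable A.
  rewrite -[X in measurable X]setTI /A.
  apply: measurable_fun_ler => //; apply: measurable_funB => //.
  exact: measurableT_comp.
have gE x : g x = \int[k1 x]_y (\1_A (x, y))%:E.
  rewrite (_ : (fun y => _) = fun y => (\1_((fun y : R => y - s x)%R @^-1` `]-oo, ratr q]%classic) y)%:E).
    rewrite integral_indic// ?setIT//.
    by rewrite -[X in measurable X]setTI; exact: msh.
  by apply/funext => y; rewrite !indicE; congr (_%:R%:E); apply/idP/idP; rewrite !inE/= in_itv.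
have mf : measurable_fun setT f by exact: mk2.
have mg : measurable_fun setT g.
  rewrite (_ : g = fun x => k1 x (xsection A x)).
    by apply: (measurable_fun_xsection_finite_kernel (prob_kernel mk1)); rewrite inE.
  apply/funext => x; congr (k1 x _).
  by apply/seteqP; split => y; rewrite /xsection/= in_itv/= inE.
have fi : mu.-integrable setT f.
  apply/integrableP; split => //.
  apply: (@le_lt_trans _ _ (\int[mu]_x (cst 1 x))).
    apply: ge0_le_integral => //; first exact: measurableT_comp.
    by move=> x _; rewrite gee0_abs// probability_le1.
  by rewrite integral_cst// mul1e /mu/= /pushforward preimage_setT probability_setT ltry.
have [N [mN N0 sN]] : ae_eq mu setT f g.
  apply: integral_ae_eq => // E _ mE.
  have mpE : measurable (p @^-1` E) by rewrite -[X in measurable X]setTI; exact: mp.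
  rewrite !ge0_integral_pushforward//; [|exact: measurable_funTS..].
  pose F (z : S * R) : \bar R := (\1_(A `&` (E `*` setT)) z)%:E.
  have mAE : measurable (A `&` (E `*` setT)) by apply: measurableI => //; exact: measurableX.
  have mF : measurable_fun setT F by exact/measurable_EFinP/measurable_indic.
  have := ge0_disintegration mp mZ mk1 kE1 mF (fun z => ltac:(by rewrite lee_fin)).
  rewrite /f -kE2//.
  have -> : \int[P]_w F (p w, Z w) =
      P (p @^-1` E `&` (fun w => Z w - s (p w))%R @^-1` `]-oo, ratr q]%classic).
    pose B := (fun w => (p w, Z w)) @^-1` (A `&` (E `*` setT)).
    have mB : measurable B.
      by rewrite -[X in measurable X]setTI; exact: (measurable_fun_pair mp mZ).
    have -> : p @^-1` E `&` (fun w => Z w - s (p w))%R @^-1` `]-oo, ratr q]%classic = B.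
      by apply/seteqP; split => w; rewrite /B /A /= in_itv/=; tauto.
    by rewrite -[B]setIT -integral_indic.
  move=> ->; rewrite [RHS]integral_mkcond; apply: eq_integral => w _.
  rewrite patchE /F; case: ifPn => wE.
    rewrite /= gE; apply: eq_integral => y _; rewrite !indicE; congr (_%:R%:E).
    by rewrite in_setI andb_idr// => _; rewrite inE; split => //; rewrite inE in wE.
  rewrite integral0_eq// => y _; rewrite indicE memNset// => -[_ [/= pE _]].
  by move: wE; rewrite mem_set.
exists (p @^-1` N); split => //; first by rewrite -[X in measurable X]setTI; exact: mp.
move=> w /= Hw; apply: sN => /= H; apply: Hw => q' [<-].
by apply: H.
Qed.

End ShiftedConditionalLaw.

(** * Quantiles and expected shortfall *)

Section Quantile.
Context {R : realType}.
Variable mu : probability R R.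

(** The identity has law [mu] under [mu], so limits and right continuity of a [cdf] transfer to
    [dfun mu]. *)
Let idRV : {RV mu >-> R} :=
  HB.pack (idfun : R -> R) (isMeasurableFun.Build _ _ _ _ (idfun : R -> R) (@measurable_id _ R setT)).

Lemma dfunE z : (dfun mu z)%:E = mu `]-oo, z]%classic.
Proof. by rewrite /dfun fineK// fin_num_measure. Qed.

Let cdfE z : cdf idRV z = (dfun mu z)%:E.
Proof. by rewrite dfunE /cdf /distribution /= /pushforward preimage_id. Qed.

Lemma dfun_nd : {homo dfun mu : x y / x <= y}.
Proof. by move=> x y xy; rewrite -lee_fin -!cdfE; exact: cdf_nondecreasing. Qed.

(** The Galois connection between quantile and distribution function. The set in the infimum is
    nonempty because F tends to 1, bounded below because F tends to 0, and contains its infimum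
    because F is right continuous. *)
Lemma quantile_le u z : 0 < u < 1 -> (quantile u mu <= z) = (u <= dfun mu z).
Proof.
move=> /andP[u0 u1]; rewrite /quantile; set A := [set _ | _].
have A0 : A !=set0.
  apply: contrapT => A0; suff : (1%:E <= u%:E)%E by rewrite lee_fin leNgt u1.
  apply: (cvge_to_le (cvg_cdfy1 idRV)); apply: nearW => x.
  rewrite cdfE lee_fin leNgt; apply/negP => ux; apply: A0.
  by exists x; exact: ltW.
have lbA : has_lbound A.
  apply: contrapT => lbA; suff : (u%:E <= 0%:E)%E by rewrite lee_fin leNgt u0.
  apply: (cvge_to_ge (cvg_cdfNy0 idRV)); apply: nearW => x.
  rewrite cdfE lee_fin leNgt; apply/negP => ux; apply: lbA.
  exists x => y /= uy; rewrite leNgt; apply/negP => yx.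
  by have := lt_le_trans ux uy; rewrite ltNge dfun_nd// ltW.
apply/idP/idP => [Az|uz]; last exact: ge_inf.
rewrite -lee_fin -cdfE.
apply: (cvge_to_ge (@cdf_right_continuous _ _ _ _ idRV z)).
near=> x; rewrite cdfE lee_fin.
have xz : inf A < x by apply: le_lt_trans Az _; near: x; exact: nbhs_right_gt.
have [y Ay yx] := inf_lt A0 xz.
by apply: le_trans Ay _; rewrite dfun_nd// ltW.
Unshelve. all: by end_near. Qed.

Lemma dfun_quantile u : 0 < u < 1 -> u <= dfun mu (quantile u mu).
Proof. by move=> u01; rewrite -quantile_le. Qed.

Lemma quantile_nd u v : 0 < u -> v < 1 -> u <= v -> quantile u mu <= quantile v mu.
Proof.
move=> u0 v1 uv; rewrite quantile_le; last by rewrite u0 (le_lt_trans uv).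
by apply: (le_trans uv); apply: dfun_quantile; rewrite (lt_le_trans u0 uv) v1.
Qed.

Lemma dfun_le1 z : dfun mu z <= 1.
Proof. by rewrite -lee_fin dfunE probability_le1. Qed.

Lemma dfun_ge0 z : 0 <= dfun mu z.
Proof. by rewrite -lee_fin dfunE. Qed.

Let D : set R := `]0, 1[%classic.
(** Outside ]0, 1[ the defining set may be empty or unbounded below; the value 0 imposed there
    yields a function on the whole line that can be integrated under the uniform law. *)
Let Q u := if 0 < u < 1 then quantile u mu else 0.

Let mQ : measurable_fun D Q.
Proof.
apply: (measurability _ (RGenOInfty.measurableE R)) => _ /= -[_ [z ->] <-].
rewrite (_ : _ `&` _ = D `&` `]dfun mu z, +oo[%classic); first by apply: measurableI; exact: measurable_itv.
apply/seteqP; split => u [uD] /= zu; split => //; move: uD zu; rewrite /D/= !in_itv/= !andbT /Q.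
  by move=> uD; rewrite uD => zu; rewrite ltNge -quantile_le// -ltNge.
by move=> uD; rewrite uD => zu; rewrite ltNge quantile_le// -ltNge.
Qed.

Lemma measurable_quantile : measurable_fun (`]0, 1[%classic : set R) (quantile ^~ mu).
Proof.
apply: eq_measurable_fun mQ => u; rewrite inE /D/= in_itv/= => uD.
by rewrite /Q uD.
Qed.

Let U : probability (measurableTypeR R) R := uniform_prob (@ltr01 R).

(* The quantile function transports the uniform law on ]0, 1[ to [mu]. *)
Lemma ge0_integral_quantile (f : R -> \bar R) : measurable_fun setT f ->
  (forall y, 0 <= f y)%E ->
  (\int[mu]_y f y = \int[lebesgue_measure]_(u in (`]0%R, 1%R[%classic : set R)) f (quantile u mu))%E.
Proof.
move=> mf f0.
have mQT : measurable_fun setT Q.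
  rewrite (_ : Q = Q \_ D); last first.
    apply/funext => u; rewrite patchE; case: ifPn => //.
    by rewrite notin_setE /D/= in_itv/= /Q => /negP/negbTE ->.
  by apply: (measurable_restrictT _ _).1 => //; exact: measurable_itv.
have intU (g : R -> \bar R) : measurable_fun setT g -> (forall y, 0 <= g y)%E ->
    (\int[U]_u g u = \int[lebesgue_measure]_(u in D) g u)%E.
  move=> mg g0; rewrite integral_uniform// subr0 invr1 mul1e integral_itv_bndoo//.
  exact: measurable_funTS.
have mfQ : measurable_fun setT (f \o Q) by exact: measurableT_comp.
transitivity (\int[U]_u ((f \o Q) u))%E; last first.
  rewrite intU//; last by move=> y; exact: f0.
  by apply: eq_integral => u; rewrite inE /D/= in_itv/= /Q => ->.
have mQT' : measurable_fun [set: measurableTypeR R] (Q : measurableTypeR R -> R).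
  exact: mQT.
have := @ge0_integral_pushforward _ _ _ _ R _ mQT' U setT f measurableT.
rewrite preimage_setT => <- //.
apply: eq_measure_integral => B mB _.
apply: measure_eq_rat_rays => //.
  exact: (le_lt_trans (probability_le1 mu measurableT) (ltry 1)).
move=> q; transitivity (dfun mu (ratr q))%:E; first by rewrite dfunE.
rewrite [RHS]/= /pushforward.
set B' := Q @^-1` _.
have mB' : measurable B'.
  by rewrite -[X in measurable X]setTI; apply: mQT => //; exact: measurable_itv.
rewrite -[B']setIT -integral_indic// intU//; last exact/measurable_EFinP/measurable_indic.
rewrite integral_indic//; last exact: measurable_itv.
set F := dfun mu (ratr q).
have F0 : 0 <= F := dfun_ge0 _.
have -> : B' `&` D = D `&` `]-oo, F]%classic.
  apply/seteqP; split => u [] /=; rewrite /B'/D/= !in_itv/= => h1 h2; split => //.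
    by rewrite -quantile_le//; move: h1; rewrite /Q h2.
  by rewrite /Q h1 quantile_le.
(* Since ]0, 1[ omits 1, the set is ]0, F] for F < 1 but all of ]0, 1[ for F = 1; its length is F
   either way. *)
have [F1|F1] := ltP F 1.
  rewrite (_ : _ `&` _ = `]0, F]%classic).
    rewrite /= lebesgue_measure_itv/= lte_fin; case: ifPn => [_|]; first by rewrite oppr0 adde0.
    by rewrite -leNgt => F0'; congr EFin; apply/eqP; rewrite eq_le F0 F0'.
  apply/seteqP; split => u /=; rewrite /D/= !in_itv/=.
    by move=> [/andP[-> _] ->].
  by move=> /andP[u0 uF]; rewrite u0 (le_lt_trans uF)//=.
have -> : F = 1 by apply/eqP; rewrite eq_le F1 dfun_le1.
rewrite setIidl; last first.
  by move=> u /=; rewrite /D/= !in_itv/= => /andP[_ /ltW].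
by rewrite /= lebesgue_measure_itv/= lte_fin ltr01 oppr0 adde0.
Qed.

Lemma integrable_quantile : mu.-integrable setT EFin ->
  lebesgue_measure.-integrable (`]0, 1[%classic : set R) (fun u => (quantile u mu)%:E).
Proof.
move=> /integrableP[_ h]; apply/integrableP; split.
  by apply/measurable_EFinP; exact: measurable_quantile.
rewrite -(ge0_integral_quantile (f := fun y => `|y%:E|%E))//.
by apply: measurableT_comp => //; exact/measurable_EFinP/measurable_id.
Qed.

(** Under the uniform transport (q - Y)^+ becomes (q - Q_u)^+, which is q - Q_u for u up to [a] and
    0 beyond, by monotonicity of quantiles. Hence its mean is a q minus the integral of Q_u over ]0,
    a]. *)
Lemma ES_quantile a : 0 < a < 1 -> mu.-integrable setT EFin ->
  ES a mu = (quantile a mu - a^-1 * \int[mu]_y Num.max (quantile a mu - y) 0)%:E.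
Proof.
move=> /andP[a0 a1] imu; set q := quantile a mu.
have iQ := integrable_quantile imu.
pose I := `]0, a]%classic : set R.
have mI : measurable I by exact: measurable_itv.
have ID : I `<=` D.
  by move=> u; rewrite /I/D/= !in_itv/= => /andP[u0 ua]; rewrite u0/= (le_lt_trans ua).
have iQI : lebesgue_measure.-integrable I (fun u => (quantile u mu)%:E).
  by apply: integrableS iQ => //; exact: measurable_itv.
have lamI : lebesgue_measure I = a%:E :> \bar R.
  by rewrite /I lebesgue_measure_itv/= lte_fin a0 oppr0 adde0.
have iqI : lebesgue_measure.-integrable I (fun=> q%:E).
  apply: measurable_bounded_integrable => //.
    by rewrite /= lamI ltry.
  exact: bounded_cst.
have E : (\int[mu]_y (Num.max (q - y) 0)%:E =
   \int[lebesgue_measure]_(u in I) (q%:E - (quantile u mu)%:E))%E.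
  rewrite (ge0_integral_quantile (f := fun y => (Num.max (q - y) 0)%:E)); last 2 first.
  - by apply/measurable_EFinP; apply: measurable_maxr => //; exact: measurable_funB.
  - by move=> y; rewrite lee_fin le_max lexx orbT.
  rewrite integral_mkcond [RHS]integral_mkcond; apply: eq_integral => u _.
  rewrite !patchE !mem_setE !in_itv/=.
  have [u0|] := ltP 0 u; rewrite //=; have [ua|au] := leP u a.
    rewrite (le_lt_trans ua a1) -EFinB; congr EFin; apply/max_idPl.
    by rewrite subr_ge0; exact: quantile_nd.
  have [u1|//] := ltP u 1; congr EFin; apply/max_idPr.
  by rewrite subr_le0; apply: quantile_nd => //; exact: ltW.
rewrite /ES -/I /Rintegral E integralB// integral_cst//= lamI.
have /fineK <- : (\int[lebesgue_measure]_(u in I) (quantile u mu)%:E)%E \is a fin_num.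
  exact: integrable_fin_num.
set x := fine (integral _ _ _).
rewrite -[LHS]/((a^-1 * x)%:E) -[X in fine X]/((q * a - x)%:E)/=.
congr EFin; field; exact: lt0r_neq0.
Qed.

End Quantile.

(** * Quantiles and integrals under translation *)

Section ShiftedLaw.
Context {R : realType} (mu nu : probability R R) (c : R).
Hypothesis nuE : forall B, measurable B -> nu B = mu ((fun y : R => y - c) @^-1` B).

Let mc : measurable_fun setT (fun y : R => y - c).
Proof. exact: measurable_funB. Qed.

(** Both sides have the same upper bounds [z], by the Galois connection applied to each law. *)
Lemma quantile_shift u : 0 < u < 1 -> quantile u nu = quantile u mu - c.
Proof.
move=> u01.
have h z : (quantile u nu <= z) = (quantile u mu - c <= z).
  rewrite quantile_le// lerBlDr quantile_le//; congr (_ <= fine _).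
  rewrite nuE; last exact: measurable_itv.
  congr (mu _); apply/seteqP; split => y /=; rewrite !in_itv/= lerBlDr//.
by apply/eqP; rewrite eq_le h lexx -h lexx.
Qed.

Lemma ge0_integral_shift (g : R -> \bar R) : measurable_fun setT g ->
  (forall y, 0 <= g y)%E -> (\int[nu]_y g y = \int[mu]_y g (y - c)%R)%E.
Proof.
move=> mg g0.
have := @ge0_integral_pushforward _ _ _ _ R _ mc mu setT g measurableT.
rewrite preimage_setT => <-//.
by apply: eq_measure_integral => B mB _; exact: nuE.
Qed.

Lemma integrable_shift : mu.-integrable setT EFin -> nu.-integrable setT EFin.
Proof.
move=> imu; apply/integrableP; split; first exact/measurable_EFinP/measurable_id.
rewrite (ge0_integral_shift (g := fun y => `|y%:E|%E))//; last first.
  by apply: measurableT_comp => //; exact/measurable_EFinP/measurable_id.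
have /integrableP[_] : mu.-integrable setT (EFin \o (fun y => y - c)).
  by apply: rintegrableB => //; exact: rintegrable_cst.
by [].
Qed.

End ShiftedLaw.

Lemma prob_square_integrable (R : realType) (mu : probability R R) :
  mu.-integrable setT (fun y => (y ^+ 2)%:E) -> mu.-integrable setT EFin.
Proof.
move=> h; apply: (@rintegrable_le _ _ _ mu id (fun y => y ^+ 2 + 1)) => //.
  by apply: rintegrableD => //; exact: rintegrable_cst.
move=> y /=; rewrite ler_norml; nra.
Qed.

(** * Laws with a density that is positive and continuous near the quantile *)

Section LocallyPositiveDensity.
Context {R : realType} (mu : probability R R) (f : R -> R) (q eps : R).
Hypothesis fE : forall B, measurable B ->
  mu B = (\int[lebesgue_measure]_(y in B) (f y)%:E)%E.
Hypothesis eps0 : 0 < eps.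
Hypothesis f_gt0 : forall y, ball q eps y -> 0 < f y.
Hypothesis cf : {within ball q eps, continuous f}.

Lemma prob_set1_density x : mu [set x] = 0%E.
Proof. by rewrite fE// integral_set1. Qed.

(** Were the mass zero, the density would vanish almost everywhere on an interval of positive length
    on which it is positive. *)
Lemma prob_itvoo_gt0 x y : x < y -> `]x, y[%classic `<=` (ball q eps : set R) ->
  (0 < mu `]x, y[%classic)%E.
Proof.
move=> xy sub; rewrite lt0e measure_ge0 andbT; apply/eqP.
(* Measurability of [f] on the interval comes from its continuity on the ball. *)
have mf : measurable_fun (`]x, y[%classic : set R) (EFin \o f).
  apply/measurable_EFinP.
  apply: subspace_continuous_measurable_fun; first exact: measurable_itv.
  exact: continuous_subspaceW cf.
rewrite fE; last exact: measurable_itv.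
have -> : (\int[lebesgue_measure]_(y in `]x, y[) (f y)%:E =
    \int[lebesgue_measure]_(y in `]x, y[) `|(f y)%:E|)%E.
  apply: eq_integral => z; rewrite inE => /sub /f_gt0 z0.
  by rewrite gee0_abs// lee_fin ltW.
move=> I0; have [N [mN N0 sN]] := (ae_eq_integral_abs (@lebesgue_measure R) (measurable_itv _) mf).1 I0.
have : (lebesgue_measure (`]x, y[%classic : set R) <= lebesgue_measure N)%E.
  apply: le_measure; rewrite ?inE; [exact: measurable_itv|exact: mN|].
  move=> z zxy; apply: sN => /= /(_ zxy) [] /eqP.
  by rewrite gt_eqF// f_gt0//; exact: sub.
by rewrite N0 lebesgue_measure_itv/= lte_fin xy -EFinB lee_fin subr_le0 leNgt xy.
Qed.

(** [v] may lie far outside the ball where the density is controlled; the part of the interval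
    within [eps] of [q] already has positive mass. *)
Lemma prob_between_gt0 v : v != q ->
  (0 < mu `]Num.min q v, Num.max q v[%classic)%E.
Proof.
move=> vq; have [qv|vq'|] := ltgtP q v; last by move=> E; rewrite E eqxx in vq.
  apply: (@lt_le_trans _ _ (mu `]q, Num.min v (q + eps)[%classic)).
    apply: prob_itvoo_gt0; first by rewrite lt_min qv ltrDl.
    move=> z /=; rewrite in_itv/= lt_min /ball/= => /andP[qz /andP[_ ze]].
    by rewrite distrC ger0_norm ?subr_ge0 ?ltW// ltrBlDl.
  apply: le_measure; rewrite ?inE; try exact: measurable_itv.
  by move=> z /=; rewrite !in_itv/= lt_min => /andP[-> /andP[->]].
apply: (@lt_le_trans _ _ (mu `]Num.max v (q - eps), q[%classic)).
  apply: prob_itvoo_gt0; first by rewrite gt_max vq' gtrBl.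
  move=> z /=; rewrite in_itv/= gt_max /ball/= => /andP[/andP[_ ze] qz].
  by rewrite ger0_norm ?subr_ge0 ?ltW// ltrBlDl -ltrBlDr.
apply: le_measure; rewrite ?inE; try exact: measurable_itv.
by move=> z /=; rewrite !in_itv/= gt_max => /andP[/andP[-> _] ->].
Qed.

(** There is no atom at [q], so F(q) is the limit of F from the left; below its quantile F stays
    under [a], and the limit is at most [a]. *)
Lemma dfun_quantile_density a : 0 < a < 1 -> quantile a mu = q ->
  dfun mu q = a.
Proof.
move=> a01 qE; apply/eqP; rewrite eq_le -{2}qE dfun_quantile// andbT.
have -> : dfun mu q = fine (mu `]-oo, q[%classic).
  rewrite /dfun; congr fine.
  have -> : `]-oo, q]%classic = `]-oo, q[%classic `|` [set q] by rewrite setUitv1.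
  by apply: measureU0; [exact: measurable_itv|exact: measurable_set1|exact: prob_set1_density].
rewrite -lee_fin fineK ?fin_num_measure//.
pose F n : set R := `]-oo, q - n.+1%:R^-1]%classic.
have FE : `]-oo, q[%classic = \bigcup_n F n.
  apply/seteqP; split => [y/=|y [n _]]; rewrite /F/= !in_itv/= => yq.
    have [n hn] := ltr_add_invr yq.
    by exists n => //=; rewrite in_itv/= lerBrDr ltW.
  by rewrite (le_lt_trans yq)// gtrBl invr_gt0.
have mF n : measurable (F n) by exact: measurable_itv.
rewrite FE; apply: (cvge_to_le (nondecreasing_cvg_mu (F := F) _ _ _)) => //.
- exact: bigcupT_measurable.
- move=> m n mn; apply/subsetPset => y; rewrite /F/= !in_itv/= => /le_trans; apply.
  by rewrite lerB// lef_pV2 ?posrE// ler_nat.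
apply: nearW => n /=; rewrite /F -dfunE lee_fin leNgt; apply/negP => h.
by have := ltW h; rewrite -quantile_le// qE leNgt gtrBl invr_gt0 ltr0n.
Qed.

End LocallyPositiveDensity.

(** * Wald consistency *)

Section OpenMeasurable.
Context {d} {S : measurableType d} {R : realType} {n : nat} (x : S -> 'rV[R]_n).
Hypothesis mx : forall i, measurable_fun setT (fun s => x s 0 i).

(** In the maximum norm an open set is a countable union of cubes with rational centres and radii
    1/(m + 1), and preimages of cubes are described by coordinates. *)
Lemma measurable_open_rV (U : set 'rV[R]_n) : open U -> measurable (x @^-1` U).
Proof.
move=> oU.
pose box (c : 'rV[rat]_n * nat) : set 'rV[R]_n :=
  [set y | forall i, `|y 0 i - ratr (c.1 0 i)| < c.2.+1%:R^-1].
have mbox c : measurable (x @^-1` box c).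
  have -> : x @^-1` box c = \bigcap_(i in [set: 'I_n])
      (fun s => x s 0 i - ratr (c.1 0 i)) @^-1` [set r | `|r| < c.2.+1%:R^-1].
    by apply/seteqP; split => [s h i _|s h i]; [exact: h|exact: (h i I)].
  apply: fin_bigcap_measurable => // i _.
  rewrite -[X in measurable X]setTI; apply: (measurable_funB (mx i) (measurable_cst _)) => //.
  rewrite (_ : [set r | _] = `](- c.2.+1%:R^-1), c.2.+1%:R^-1[%classic); first exact: measurable_itv.
  by apply/seteqP; split => r /=; rewrite in_itv/= ltr_norml.
pose F m := if unpickle m is Some c then
  if `[< box c `<=` U >] then x @^-1` box c else set0 else set0.
have -> : x @^-1` U = \bigcup_m F m.
  apply/seteqP; split => [s /= Us|s [m _]]; last first.
    rewrite /F; case: (unpickle m) => // c; case: ifPn => // /asboolP; exact.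
  have /nbhs_ballP[e /= e0 eU] : nbhs (x s) U by apply: open_nbhs_nbhs.
  (* Half of [e]: the rational centre is within 1/(m + 1) of the point, and the cube around it adds
     as much again. *)
  have e20 : 0 < (e : R) / 2 by rewrite divr_gt0.
  have [m] := ltr_add_invr e20.
  rewrite add0r => me.
  have hq i : exists q : rat, x s 0 i < ratr q < x s 0 i + m.+1%:R^-1.
    have [|q] := @rat_in_itvoo R (x s 0 i) (x s 0 i + m.+1%:R^-1); first by rewrite ltrDl.
    by rewrite in_itv/=; exists q.
  pose c : 'rV[rat]_n * nat := (\row_i sval (cid (hq i)), m).
  have cP i : x s 0 i < ratr (c.1 0 i) < x s 0 i + m.+1%:R^-1.
    by rewrite mxE; case: cid.
  have cU : box c `<=` U.
    move=> y yc; apply: eU; split => // i j; rewrite !ord1.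
    have : `|y 0 j - ratr (c.1 0 j)| < m.+1%:R^-1 := yc j.
    have /andP[] := cP j; rewrite /ball/= ltr_norml => h1 h2 /andP[h3 h4].
    clear - h1 h2 h3 h4 me e20; rewrite ltr_norml.
    set t := _^-1 in me h2 h3 h4; set r := ratr _ in h1 h2 h3 h4.
    by apply/andP; split; lra.
  exists (pickle c); first exact: I.
  rewrite /F pickleK; case: asboolP => // _ i.
  have : m.+1%:R^-1 > 0 :> R by rewrite invr_gt0.
  have /andP[h1 h2] := cP i; rewrite -[c.2]/m ltr_norml.
  clear - h1 h2; set t := _^-1 in h2 *; set r := ratr _ in h1 h2 *.
  by move=> t0; apply/andP; split; lra.
apply: bigcupT_measurable => m; rewrite /F; case: (unpickle m) => // c.
by case: ifPn.
Qed.

Context {V : Type} (A : set V) (h : V -> 'rV[R]_n -> R).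
Hypothesis ch : forall v, A v -> continuous (h v).

(** The family may be uncountable, but the supremum exceeds [c] exactly on the preimage of a union
    of open sets, which is open whatever the number of its members. *)
Lemma measurable_sup_continuous :
  (forall s, has_sup [set h v (x s) | v in A]) ->
  measurable_fun setT (fun s => sup [set h v (x s) | v in A]).
Proof.
move=> hs; apply: (measurability _ (RGenOInfty.measurableE R)) => _ /= -[_ [c ->] <-].
rewrite setTI (_ : _ @^-1` _ = x @^-1` \bigcup_(v in A) [set y | c < h v y]).
  apply: measurable_open_rV; apply: bigcup_open => v Av.
  by apply: (open_comp _ (@open_gt R c)) => y _; exact: ch.
apply/seteqP; split => s /=; rewrite in_itv/= andbT.
  by move=> /(sup_gt (hs s).1)[_ [v Av <-] cv]; exists v.
move=> [v Av /= cv]; apply: (lt_le_trans cv); apply: ub_le_sup; first exact: (hs s).2.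
by exists v.
Qed.

Lemma measurable_inf_continuous :
  (forall s, has_inf [set h v (x s) | v in A]) ->
  measurable_fun setT (fun s => inf [set h v (x s) | v in A]).
Proof.
move=> hs; apply: (measurability _ (RGenInftyO.measurableE R)) => _ /= -[_ [c ->] <-].
rewrite setTI (_ : _ @^-1` _ = x @^-1` \bigcup_(v in A) [set y | h v y < c]).
  apply: measurable_open_rV; apply: bigcup_open => v Av.
  by apply: (open_comp _ (@open_lt R c)) => y _; exact: ch.
apply/seteqP; split => s /=; rewrite in_itv/=.
  by move=> /(inf_lt (hs s).1)[_ [v Av <-] cv]; exists v.
move=> [v Av /= cv]; apply: le_lt_trans cv; apply: ge_inf; first exact: (hs s).2.
by exists v.
Qed.

End OpenMeasurable.

Lemma measurable_continuous_rV d (S : measurableType d) (R : realType) n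
  (x : S -> 'rV[R]_n) (h : 'rV[R]_n -> R) :
  (forall i, measurable_fun setT (fun s => x s 0 i)) -> continuous h ->
  measurable_fun setT (h \o x).
Proof.
move=> mx ch; apply: (measurability _ (RGenOInfty.measurableE R)) => _ /= -[_ [c ->] <-].
rewrite setTI comp_preimage; apply: measurable_open_rV => //.
by apply: open_comp => [y _|]; [exact: ch|exact: itv_open_ends_open].
Qed.

(** * Outer probability *)

Section OuterProb.
Context {d} {T : measurableType d} {R : realType} (P : probability T R).
Implicit Types A B : set T.
Local Open Scope ereal_scope.

Lemma outer_prob_ge0 A : 0 <= outer_prob P A.
Proof. by apply: le_ereal_inf_tmp => _ [B _ <-]. Qed.

Lemma outer_prob_le A B : A `<=` B -> outer_prob P A <= outer_prob P B.
Proof.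
move=> AB; apply: ereal_inf_le_tmp => _ [C [mC BC] <-].
by exists C => //; split => //; exact: subset_trans BC.
Qed.

Lemma outer_prob_le_measurable A B : measurable B -> A `<=` B -> outer_prob P A <= P B.
Proof. by move=> mB AB; apply: ereal_inf_lbound; exists B. Qed.

(** Each set is enclosed in a measurable one whose probability exceeds its outer probability by less
    than e / 2. *)
Lemma outer_probU A B : outer_prob P (A `|` B) <= outer_prob P A + outer_prob P B.
Proof.
have ofin C : outer_prob P C \is a fin_num.
  rewrite ge0_fin_numE ?outer_prob_ge0//.
  apply: (@le_lt_trans _ _ (P setT)); first exact: outer_prob_le_measurable.
  by rewrite probability_setT ltry.
apply/lee_addgt0Pr => e e0.
have e20 : (0 < e / 2)%R by rewrite divr_gt0.
have [_ [C [mC AC] <-] hC] := lb_ereal_inf_adherent e20 (ofin A).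
have [_ [D [mD BD] <-] hD] := lb_ereal_inf_adherent e20 (ofin B).
apply: (@le_trans _ _ (P C + P D)).
  apply: (@le_trans _ _ (P (C `|` D))); last exact: measureU2.
  by apply: outer_prob_le_measurable; [exact: measurableU|exact: setUSS].
apply: le_trans (leeD (ltW hC) (ltW hD)) _.
by rewrite addeACA -EFinD -splitr.
Qed.

Lemma outer_prob_cvg0P (A : nat -> set T) :
  (fun n => outer_prob P (A n)) @ \oo --> 0 <->
  forall e : R, (0 < e)%R -> \forall n \near \oo, outer_prob P (A n) <= e%:E.
Proof.
split => [h e e0|h].
  have : \forall x \near (0 : \bar R), x < e%:E by apply: open_ereal_lt'; rewrite lte_fin.
  move=> /h; rewrite /nbhs/=; apply: filterS => n; exact: ltW.
apply/fine_cvgP; split.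
  have := h _ ltr01; apply: filterS => n hn.
  by rewrite ge0_fin_numE ?outer_prob_ge0// (le_lt_trans hn)// ltry.
apply/cvgrPdist_le => e e0; have := h _ e0; apply: filterS => n hn.
rewrite sub0r normrN ger0_norm ?fine_ge0 ?outer_prob_ge0//.
by rewrite -lee_fin fineK// ge0_fin_numE ?outer_prob_ge0// (le_lt_trans hn)// ltry.
Qed.

End OuterProb.

(** * The covering argument for an abstract excess loss *)

Section Wald.
Context {d} {T : measurableType d} {R : realType} (P : probability T R).
Context {d'} {S : measurableType d'} (Zs : nat -> T -> S) (Z : T -> S).
Hypothesis mZs : forall i, measurable_fun setT (Zs i).
Hypothesis mZ : measurable_fun setT Z.
Hypothesis same_law : forall i (A : set S), measurable A ->
  P (Zs i @^-1` A) = P (Z @^-1` A).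
Hypothesis pairwise_indep : forall i j (A B : set S), i != j ->
  measurable A -> measurable B ->
  P (Zs i @^-1` A `&` Zs j @^-1` B) = (P (Zs i @^-1` A) * P (Zs j @^-1` B))%E.

Context {V : normedModType R} (Theta : set V) (th0 : V).
Variables (ell : S -> V -> R) (envelope : S -> R).
Hypothesis cTheta : compact Theta.
Hypothesis cell : forall s, continuous (ell s).
Hypothesis mell : forall th, measurable_fun setT (ell^~ th).
Hypothesis minf : forall th r, Theta th -> 0 < r ->
  measurable_fun setT (fun s => inf [set ell s t | t in Theta `&` ball th r]).
Hypothesis ell_le : forall s th, Theta th -> `|ell s th| <= envelope s.
Hypothesis ienv : rintegrable P (envelope \o Z).
Hypothesis ell_gt0 : forall th, Theta th -> th != th0 ->
  0 < \int[P]_w ell (Z w) th.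

Lemma wald_local th : Theta th -> th != th0 -> exists (r : R) (g : S -> R),
  [/\ 0 < r, measurable_fun setT g, rintegrable P (g \o Z),
      0 < \int[P]_w g (Z w) &
      forall s t, Theta t -> ball th r t -> g s <= ell s t].
Proof.
move=> Tth thth0.
pose r n : R := n.+1%:R^-1.
have r0 n : 0 < r n by rewrite invr_gt0.
pose g n s := inf [set ell s t | t in Theta `&` ball th (r n)].
have g_le n s t : Theta t -> ball th (r n) t -> g n s <= ell s t.
  move=> Tt bt; apply: ge_inf; last by exists t.
  exists (- envelope s) => _ [u [Tu _] <-].
  by have := ell_le s Tu; rewrite ler_norml => /andP[].
have le_g n s c : (forall t, Theta t -> ball th (r n) t -> c <= ell s t) -> c <= g n s.
  move=> h; apply: lb_le_inf.
    by exists (ell s th), th => //; split => //; exact: ballxx.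
  by move=> _ [t [Tt bt] <-]; exact: h.
have g_env n s : `|g n s| <= envelope s.
  rewrite ler_norml; apply/andP; split.
    apply: le_g => t Tt _; by have := ell_le s Tt; rewrite ler_norml => /andP[].
  apply: (le_trans (g_le n s th Tth (ballxx _ (r0 n)))).
  by apply: le_trans (ell_le s Tth); exact: ler_norm.
have mg n : measurable_fun setT (g n) by exact: minf.
(* As the radius shrinks, continuity keeps [ell s] above [ell s th - e] on the ball, while [th]
   itself lies in every ball; so the infima tend to [ell s th]. *)
have g_cvg s : (g n s)%:E @[n --> \oo] --> (ell s th)%:E.
  apply: cvg_EFin; first exact: nearW.
  apply/cvgrPdist_le => e e0.
  have /nbhs_ballP[del /= del0 Hdel] : \forall t \near th, `|ell s th - ell s t| <= e.
    by move: (@cell s th) => /cvgrPdist_le; apply.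
  near=> n.
  have rdel : r n <= del by apply: ltW; near: n; exact: (near_infty_natSinv_lt (PosNum del0)).
  rewrite ger0_norm ?subr_ge0; last by apply: g_le => //; exact: ballxx.
  rewrite lerBlDl -lerBlDr; apply: le_g => t Tt bt.
  have := Hdel t (le_ball rdel bt); rewrite ler_norml => /andP[_].
  by rewrite !lerBlDr addrC.
have [_ _ /= gl] := @dominated_convergence _ _ _ P setT measurableT
  (fun n w => (g n (Z w))%:E) (fun w => (ell (Z w) th)%:E) (fun w => (envelope (Z w))%:E)
  (fun n => (measurable_EFinP _ _).2 (measurableT_comp (mg n) mZ))
  ((measurable_EFinP _ _).2 (measurableT_comp (mell th) mZ))
  (aeW _ (fun w _ => g_cvg (Z w))) ienv
  (aeW _ (fun w n _ => g_env n (Z w))).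
have iell : rintegrable P (fun w => ell (Z w) th).
  by apply: (rintegrable_le _ ienv) => [|w]; [exact: (measurableT_comp (mell th) mZ)|exact: ell_le].
have ig n : rintegrable P (g n \o Z).
  by apply: (rintegrable_le _ ienv) => [|w]; [exact: (measurableT_comp (mg n) mZ)|exact: g_env].
have [N _ hN] : \forall n \near \oo, (0 < \int[P]_w (g n (Z w))%:E)%E.
  have : \forall x \near (\int[P]_w (ell (Z w) th)%:E)%E, (0 < x)%E.
    by apply: open_ereal_gt'; rewrite RintegralE// lte_fin; exact: ell_gt0.
  by move=> /gl.
exists (r N), (g N); split => //; last by move=> s t; exact: g_le.
by rewrite -lte_fin -RintegralE; [exact: (hN N (leqnn N))|exact: ig].
Unshelve. all: by end_near. Qed.

Variable thetahat : nat -> T -> V.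
Hypothesis thetahatT : forall n w, Theta (thetahat n w).
Hypothesis approx_min : forall c, 0 < c -> (fun n => outer_prob P
  [set w | (\sum_(i < n) ell (Zs i w) (thetahat n w)) / n%:R > c]) @ \oo --> 0%E.

Theorem wald_consistency (eps : R) : 0 < eps ->
  (fun n => outer_prob P [set w | ~ ball th0 eps (thetahat n w)]) @ \oo --> 0%E.
Proof.
move=> eps0.
(* A radius is chosen for every point of [V]; where nothing is claimed, outside [Theta] and at
   [th0], it is 1. *)
have /choice[rad radP] : forall th, exists r : R, 0 < r /\ (Theta th -> th != th0 ->
    forall e : R, 0 < e ->
    \forall n \near \oo, (outer_prob P [set w | ball th r (thetahat n w)] <= e%:E)%E).
  move=> th; have [[Tth thth0]|H] := pselect (Theta th /\ th != th0); last first.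
    by exists 1; split => // ? ?; exfalso; apply: H.
  have [r [g [r0 mg ig g0 gl]]] := wald_local Tth thth0.
  (* Half the mean leaves room on both sides: the average excess loss at the estimator rarely
     exceeds [c], and the average of the minorant rarely stays below it. *)
  exists r; split => // _ _ e e0; pose c := (\int[P]_w g (Z w)) / 2.
  have c0 : 0 < c by rewrite divr_gt0.
  have cm : c < \int[P]_w g (Z w) by rewrite /c; lra.
  have e20 : 0 < e / 2 by rewrite divr_gt0.
  have /outer_prob_cvg0P/(_ _ e20) h1 := approx_min c0.
  have h2 := wlln_lower_tail mZs mZ same_law pairwise_indep mg ig cm e20.
  near=> n.
  have n1 : (outer_prob P [set w | ((\sum_(i < n) ell (Zs i w) (thetahat n w)) / n%:R > c)%R]
      <= (e / 2)%:E)%E by near: n.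
  have n2 : (P [set w | ((\sum_(i < n) g (Zs i w)) / n%:R <= c)%R] <= (e / 2)%:E)%E
    by near: n.
  rewrite [e]splitr EFinD; apply: le_trans (leeD n1 n2).
  have mA : measurable [set w | (\sum_(i < n) g (Zs i w)) / n%:R <= c].
    rewrite -[X in measurable X]setTI.
    by apply: measurable_fun_ler => //; exact: (measurable_avg mZs).
  apply: le_trans (leeD (lexx _) (outer_prob_le_measurable P mA (@subset_refl _ _))).
  (* While the estimator is in the ball, the average excess loss dominates the average of [g], so
     one of the two rare events occurs. *)
  apply: le_trans (outer_probU P _ _); apply: outer_prob_le => w /= bw.
  have [h|h] := leP ((\sum_(i < n) g (Zs i w)) / n%:R) c; first by right.
  left; apply: (lt_le_trans h).
  rewrite ler_wpM2r ?invr_ge0//; apply: ler_sum => i _.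
  by apply: gl.
(* The set attached to [th0] is the target ball; an estimator outside it must lie in one of the
   finitely many improbable balls. *)
pose f th : set V := if th == th0 then ball th0 eps else ball th (rad th).
have [D DT cov] : finite_subset_cover Theta f Theta.
  move: cTheta; rewrite compact_cover; apply.
    by move=> th _; rewrite /f; case: ifP => _; exact: ball_open.
  move=> th Tth; exists th => //; rewrite /f; case: eqP => [->|_].
    exact: ballxx.
  by apply: ballxx; exact: (radP th).1.
apply/outer_prob_cvg0P.
pose bad (s : seq V) n := [set w | exists2 th, th \in s & th != th0 /\ ball th (rad th) (thetahat n w)].
have Hbad (s : seq V) : (forall th, th \in s -> Theta th) -> forall e : R, 0 < e ->
    \forall n \near \oo, (outer_prob P (bad s n) <= e%:E)%E.
  elim: s => [_ e e0|th s ih sT e e0].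
    apply: nearW => n; apply: (@le_trans _ _ 0%E); last by rewrite lee_fin ltW.
    rewrite -(measure0 P); apply: outer_prob_le_measurable => // w [th].
    by rewrite in_nil.
  have e20 : 0 < e / 2 by rewrite divr_gt0.
  have sT' t : t \in s -> Theta t by move=> ts; apply: sT; rewrite inE ts orbT.
  have h1 := ih sT' _ e20.
  have [E|nE] := eqVneq th th0.
    near=> n; apply: (@le_trans _ _ (e / 2)%:E); last by rewrite lee_fin; lra.
    apply: (@le_trans _ _ (outer_prob P (bad s n))); last by near: n.
    apply: outer_prob_le => w [t + [tn bt]]; rewrite inE => /predU1P[tE|ts].
      by rewrite tE E eqxx in tn.
    by exists t.
  have thT : Theta th by apply: sT; rewrite mem_head.
  have h2 := (radP th).2 thT nE _ e20.
  near=> n.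
  have n1 : (outer_prob P (bad s n) <= (e / 2)%:E)%E by near: n.
  have n2 : (outer_prob P [set w | ball th (rad th) (thetahat n w)] <= (e / 2)%:E)%E
    by near: n.
  rewrite [e]splitr EFinD; apply: le_trans (leeD n1 n2).
  apply: le_trans (outer_probU P _ _); apply: outer_prob_le => w [t + [tn bt]].
  rewrite inE => /predU1P[<-|ts]; first by right.
  by left; exists t.
move=> e e0.
have DT' th : th \in finmap.enum_fset D -> Theta th.
  by move=> thD; have := DT th thD; rewrite inE.
have := Hbad _ DT' e e0; apply: filterS.
move=> n; apply: le_trans; apply: outer_prob_le => w /= nb.
have [th thD] := cov _ (thetahatT n w); rewrite /f; case: eqP => [//|/eqP thn] bt.
by exists th.
Unshelve. all: by end_near. Qed.

End Wald.

(** * Identification of the minimiser *)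

(** The expression is the Bregman divergence f(e0) - f(e) - g(e)(e0 - e). The mean value theorem
    writes it as (e - e0)(g(e) - g(c)) with c strictly between, and [g] is strictly increasing. *)
Lemma strictly_convex_tangent (R : realType) (f g : R -> R) :
  (forall x, derivable f x 1) -> (forall x, derivable g x 1) ->
  derive1 f = g -> (forall x, 0 < derive1 g x) ->
  forall e e0, e != e0 -> 0 < g e * (e - e0) - f e + f e0.
Proof.
move=> df dg fg g'0.
have cont (h : R -> R) A : (forall x, derivable h x 1) -> {within A, continuous h}.
  move=> dh; apply: continuous_subspaceT => x.
  exact/differentiable_continuous/derivable1_diffP.
have mono x y : x < y -> g x < g y.
  move=> xy; have [|c _] := @MVT _ g (derive1 g) _ _ xy _ (cont _ _ dg).
    by move=> z _; rewrite derive1E; exact/derivableP.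
  move=> E; rewrite -subr_gt0 E mulr_gt0// subr_gt0//.
have mvt x y : x < y -> exists2 c, x < c < y & f y - f x = g c * (y - x).
  move=> xy; have [|c] := @MVT _ f g _ _ xy _ (cont _ _ df).
    by move=> z _; rewrite -fg derive1E; exact/derivableP.
  by rewrite in_itv/=; exists c.
move=> e e0 ee0; have [h|h|E] := ltgtP e e0; last by rewrite E eqxx in ee0.
- have [c /andP[ec _] E] := mvt _ _ h.
  have -> : g e * (e - e0) - f e + f e0 = (e0 - e) * (g c - g e).
    have -> : f e0 = f e + g c * (e0 - e) by rewrite -E; ring.
    ring.
  by rewrite mulr_gt0 ?subr_gt0// mono.
- have [c /andP[_ ce] E] := mvt _ _ h.
  have -> : g e * (e - e0) - f e + f e0 = (e - e0) * (g e - g c).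
    have -> : f e = f e0 + g c * (e - e0) by rewrite -E; ring.
    ring.
  by rewrite mulr_gt0 ?subr_gt0// mono.
Qed.

Section Loss.
Context {R : realType} (alpha : R) (G1 G2 calG2 : R -> R).

(* The summand [- 1{y <= v} * G1 y] of the loss is discontinuous in [v]; adding
   [G1 y], which is free of the parameter, turns the jump into a maximum. *)
Definition loss_core (y v e : R) : R :=
  G1 (Num.max v y) - alpha * G1 v
  + G2 e * (e - v + Num.max (v - y) 0 / alpha) - calG2 e.

Lemma rho_lossE k (a : R -> R) y (x : 'rV[R]_k) th :
  rho_loss alpha G1 G2 calG2 a y x th =
  loss_core y (dotr x (thq th)) (dotr x (the th)) - G1 y + a y.
Proof.
rewrite /rho_loss /loss_core; case: leP => h.
  by rewrite (max_idPl _) ?subr_ge0//; ring.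
by rewrite (max_idPr _) ?subr_le0 ?ltW//; ring.
Qed.

Let ind (y q : R) : R := if y <= q then 1 else 0.

(** The convexity gap of v -> (v - y)^+ between [q] and [v], with [ind y q] as subgradient at
    [q]. *)
Definition check_gap (y q v : R) : R :=
  Num.max (v - y) 0 - Num.max (q - y) 0 - ind y q * (v - q).

Lemma check_gap_ge0 y q v : 0 <= check_gap y q v.
Proof. by rewrite /check_gap /ind !maxEle; do 3 case: ifPn; lra. Qed.

(** For [y] strictly between [q] and [v] the gap equals |v - y|. *)
Lemma check_gap_gt0 y q v : Num.min q v < y -> y < Num.max q v ->
  0 < check_gap y q v.
Proof.
by rewrite /check_gap /ind minElt !maxEle; do ?[case: ifPn]; lra.
Qed.

Hypothesis alpha01 : 0 < alpha < 1.
Hypothesis G1_nd : {homo G1 : x y / x <= y}.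
Hypothesis G2_gt0 : forall x, 0 < G2 x.

(* With [q] the conditional quantile and [e0] the conditional expected shortfall,
   the first two terms on the left have conditional mean zero and the others are
   nonnegative. *)
Lemma loss_core_ge y v e q e0 :
  (G1 v - G1 q + G2 e * (v - q) / alpha) * (ind y q - alpha)
  + (G2 e - G2 e0) * (e0 - q + Num.max (q - y) 0 / alpha)
  + (G2 e * (e - e0) - calG2 e + calG2 e0 + G2 e * check_gap y q v / alpha)
  <= loss_core y v e - loss_core y q e0.
Proof.
have a0 : alpha != 0 by case/andP: alpha01 => /lt0r_neq0.
(* The only inequality: monotonicity of [G1] makes the discarded remainder nonnegative, and
   everything else is an algebraic identity. *)
have h : ind y q * (G1 v - G1 q) <= G1 (Num.max v y) - G1 (Num.max q y).
  rewrite /ind; case: (leP y q) => yq /=; rewrite ?mul1r ?mul0r.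
    by rewrite lerD2r G1_nd// le_max lexx.
  by rewrite subr_ge0 G1_nd// le_max lexx orbT.
rewrite -subr_ge0; rewrite -subr_ge0 in h; apply: le_trans h _; apply: eq_ler.
by rewrite /loss_core /check_gap; field.
Qed.

(** Source of the envelope: for linear forms in [X] with bounded parameters, each term on the right
    is controlled by a moment condition. *)
Lemma loss_core_norm_le y v e : `|loss_core y v e| <=
  2 * `|G1 v| + `|G1 y| + `|G2 e| * (`|e| + `|v| + (`|v| + `|y|) / alpha) + `|calG2 e|.
Proof.
have /andP[a0 a1] := alpha01.
have h1 : `|G1 (Num.max v y)| <= `|G1 v| + `|G1 y|.
  by rewrite maxEle; case: ifPn => _; rewrite ?lerDl ?lerDr.
have h2 : `|alpha * G1 v| <= `|G1 v|.
  by rewrite normrM gtr0_norm// ler_piMl// ltW.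
have h3 : `|Num.max (v - y) 0 / alpha| <= (`|v| + `|y|) / alpha.
  rewrite normrM [X in _ * X]gtr0_norm ?invr_gt0// ler_pM2r ?invr_gt0//.
  rewrite maxEle; case: ifPn => _; first by rewrite normr0 addr_ge0.
  exact: ler_normB.
have h4 : `|G2 e * (e - v + Num.max (v - y) 0 / alpha)| <=
    `|G2 e| * (`|e| + `|v| + (`|v| + `|y|) / alpha).
  rewrite normrM ler_wpM2l//; apply: le_trans (ler_normD _ _) _.
  by rewrite lerD// ler_normB.
rewrite /loss_core; apply: le_trans (ler_normB _ _) _; rewrite lerD2r.
apply: le_trans (ler_normD _ _) _; apply: lerD h4.
apply: le_trans (ler_normB _ _) _; rewrite [2 * _]mulr_natl mulr2n.
by move: h1 h2; lra.
Qed.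

End Loss.

Section Identification.
Context {d} {T : measurableType d} {R : realType} (P : probability T R).
Context {d'} {S : measurableType d'} (p : T -> S) (Y : T -> R).
Variable k : S -> probability R R.
Hypothesis mp : measurable_fun setT p.
Hypothesis mY : measurable_fun setT Y.
Hypothesis mk : forall B, measurable B -> measurable_fun setT (k ^~ B).
Hypothesis kE : forall A B, measurable A -> measurable B ->
  P (p @^-1` A `&` Y @^-1` B) = (\int[P]_(w in p @^-1` A) k (p w) B)%E.

Lemma conditional_mean0 (f : S * R -> R) : measurable_fun setT f ->
  rintegrable P (fun w => f (p w, Y w)) ->
  {ae P, forall w, (\int[k (p w)]_y (f (p w, y))%:E = 0)%E} ->
  \int[P]_w f (p w, Y w) = 0.
Proof.
move=> mf fi f0; rewrite /Rintegral (disintegration mp mY mk kE mf fi).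
rewrite (_ : integral _ _ _ = 0%E)//.
rewrite (@ae_eq_integral _ _ _ P setT (cst 0%E)) ?integral0//.
- exact: measurable_kernel_integral.
- by apply: filterS f0 => w h _.
Qed.

Variables (alpha : R) (G1 G2 calG2 : R -> R) (v e q e0 : S -> R).
Hypothesis alpha01 : 0 < alpha < 1.
Hypothesis G1_nd : {homo G1 : x y / x <= y}.
Hypothesis G2_gt0 : forall x, 0 < G2 x.
Hypothesis G2_tangent : forall x x0, x != x0 -> 0 < G2 x * (x - x0) - calG2 x + calG2 x0.
Hypothesis mG1 : measurable_fun setT G1.
Hypothesis mG2 : measurable_fun setT G2.
Hypothesis mcalG2 : measurable_fun setT calG2.
Hypothesis mv : measurable_fun setT v.
Hypothesis me : measurable_fun setT e.
Hypothesis mq : measurable_fun setT q.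
Hypothesis me0 : measurable_fun setT e0.
Hypothesis cond_quantile : {ae P, forall w, dfun (k (p w)) (q (p w)) = alpha}.
Hypothesis cond_integrable : {ae P, forall w, (k (p w)).-integrable setT EFin}.
Hypothesis cond_ES : {ae P, forall w,
  \int[k (p w)]_y Num.max (q (p w) - y) 0 = alpha * (q (p w) - e0 (p w))}.
Hypothesis cond_pos : {ae P, forall w, forall x, x != q (p w) ->
  (0 < k (p w) `]Num.min (q (p w)) x, Num.max (q (p w)) x[%classic)%E}.
Hypothesis iG1v : rintegrable P (fun w => G1 (v (p w))).
Hypothesis iG1q : rintegrable P (fun w => G1 (q (p w))).
Hypothesis iG2v : rintegrable P (fun w => G2 (e (p w)) * (v (p w) - q (p w))).
Hypothesis iG2W : rintegrable P (fun w => (G2 (e (p w)) - G2 (e0 (p w))) *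
  (e0 (p w) - q (p w) + Num.max (q (p w) - Y w) 0 / alpha)).
Let diff w := loss_core alpha G1 G2 calG2 (Y w) (v (p w)) (e (p w)) -
  loss_core alpha G1 G2 calG2 (Y w) (q (p w)) (e0 (p w)).
Hypothesis idiff : rintegrable P diff.
Hypothesis distinct : ~ {ae P, forall w, v (p w) = q (p w) /\ e (p w) = e0 (p w)}.

(** The three groups of terms of [loss_core_ge], read at the pair formed by the conditioning point
    and the response: [f1] carries the quantile identification function, [f2] that of expected
    shortfall, and [g] the nonnegative remainder. *)
Let f1 (z : S * R) := (G1 (v z.1) - G1 (q z.1) + G2 (e z.1) * (v z.1 - q z.1) / alpha)
  * ((if z.2 <= q z.1 then 1 else 0) - alpha).
Let f2 (z : S * R) := (G2 (e z.1) - G2 (e0 z.1)) *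
  (e0 z.1 - q z.1 + Num.max (q z.1 - z.2) 0 / alpha).
Let g (z : S * R) := G2 (e z.1) * (e z.1 - e0 z.1) - calG2 (e z.1) + calG2 (e0 z.1)
  + G2 (e z.1) * check_gap z.2 (q z.1) (v z.1) / alpha.

Let m1 (h : S -> R) : measurable_fun setT h -> measurable_fun setT (fun z : S * R => h z.1).
Proof. by move=> mh; apply: (measurableT_comp mh). Qed.

Let mind : measurable_fun setT (fun z : S * R => (if z.2 <= q z.1 then 1 else 0) : R).
Proof.
apply: measurable_fun_ifT => //; apply: measurable_fun_ler => //; exact: m1.
Qed.

Let mc (G : R -> R) (h : S -> R) : measurable_fun setT G -> measurable_fun setT h ->
  measurable_fun setT (fun z : S * R => G (h z.1)).
Proof. by move=> mG mh; apply: (measurableT_comp mG (m1 mh)). Qed.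

Let mmax (h : S -> R) : measurable_fun setT h ->
  measurable_fun setT (fun z : S * R => Num.max (h z.1 - z.2) 0).
Proof.
move=> mh; apply: measurable_maxr => //; apply: measurable_funB => //; exact: m1.
Qed.

Let mf1 : measurable_fun setT f1.
Proof.
apply: measurable_funM; last by apply: measurable_funB => //; exact: mind.
apply: measurable_funD; first exact: (measurable_funB (mc mG1 mv) (mc mG1 mq)).
apply: measurable_funM => //.
exact: (measurable_funM (mc mG2 me) (measurable_funB (m1 mv) (m1 mq))).
Qed.

Let mf2 : measurable_fun setT f2.
Proof.
apply: measurable_funM; first exact: (measurable_funB (mc mG2 me) (mc mG2 me0)).
apply: measurable_funD; first exact: (measurable_funB (m1 me0) (m1 mq)).
by apply: measurable_funM => //; exact: mmax.
Qed.

Let mg : measurable_fun setT g.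
Proof.
apply: measurable_funD.
  apply: measurable_funD; last exact: (mc mcalG2 me0).
  apply: measurable_funB; last exact: (mc mcalG2 me).
  exact: (measurable_funM (mc mG2 me) (measurable_funB (m1 me) (m1 me0))).
apply: measurable_funM => //; apply: measurable_funM; first exact: (mc mG2 me).
apply: measurable_funB; first exact: (measurable_funB (mmax mv) (mmax mq)).
exact: (measurable_funM mind (measurable_funB (m1 mv) (m1 mq))).
Qed.

Let g_ge0 z : 0 <= g z.
Proof.
apply: addr_ge0.
  have [->|h] := eqVneq (e z.1) (e0 z.1); last exact/ltW/G2_tangent.
  by rewrite subrr mulr0 sub0r addNr.
rewrite divr_ge0//; last by case/andP: alpha01 => /ltW.
by rewrite mulr_ge0 ?check_gap_ge0// ltW.
Qed.

Let if1 : rintegrable P (fun w => f1 (p w, Y w)).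
Proof.
have /andP[a0 a1] := alpha01.
have i : rintegrable P (fun w => G1 (v (p w)) - G1 (q (p w)) +
    G2 (e (p w)) * (v (p w) - q (p w)) / alpha).
  apply: rintegrableD; first exact: rintegrableB.
  by under eq_fun do rewrite mulrC; exact: rintegrableZ.
apply: (rintegrable_le _ (rintegrable_norm i)).
  exact: (measurableT_comp mf1 (measurable_fun_pair mp mY)).
(* The second factor is 1 - alpha or - alpha, hence at most 1 in absolute value. *)
move=> w; rewrite /f1 normrM ler_piMr//=; case: ifPn => _.
  by rewrite ger0_norm ?subr_ge0 ?gerBl; exact: ltW.
by rewrite sub0r normrN gtr0_norm//; exact: ltW.
Qed.

(** Given the conditioning point, the indicator has mean F(q) = alpha. *)
Let If1 : \int[P]_w f1 (p w, Y w) = 0.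
Proof.
apply: conditional_mean0 => //; apply: filterS cond_quantile => w hw.
have mray : measurable (`]-oo, q (p w)]%classic : set R) by exact: measurable_itv.
have indE y : (if y <= q (p w) then 1 else 0) = \1_(`]-oo, q (p w)]%classic) y :> R.
  rewrite indicE; case: ifPn => h; first by rewrite mem_set//= in_itv/= h.
  by rewrite memNset//= in_itv/=; exact/negP.
have i1 : rintegrable (k (p w)) (fun y => (if y <= q (p w) then 1 else 0) - alpha).
  apply: rintegrableB; last exact: rintegrable_cst.
  by under eq_fun do rewrite indE; exact: rintegrable_indic.
rewrite /f1 /= RintegralE; last exact: rintegrableZ.
rewrite RintegralZl// RintegralB//; [|by under eq_fun do rewrite indE; exact: rintegrable_indic|exact: rintegrable_cst].
rewrite prob_Rintegral_cst; under eq_Rintegral do rewrite indE.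
by rewrite Rintegral_indic// -[fine _]/(dfun (k (p w)) (q (p w))) hw subrr mulr0.
Qed.

(** Given the conditioning point, (q - Y)^+ / alpha has mean q - e0 by [cond_ES]. *)
Let If2 : \int[P]_w f2 (p w, Y w) = 0.
Proof.
have /andP[a0 a1] := alpha01.
apply: conditional_mean0 => //; apply: filterS2 cond_integrable cond_ES => w iw hw.
have i0 : rintegrable (k (p w)) (fun y => Num.max (q (p w) - y) 0).
  have i' : rintegrable (k (p w)) (fun y => `|q (p w) - y|).
    by apply/rintegrable_norm/rintegrableB => //; exact: rintegrable_cst.
  apply: (rintegrable_le _ i').
    by apply: measurable_maxr => //; exact: measurable_funB.
  by move=> y; rewrite maxEle; case: ifPn; rewrite ?normr0.
have i1 : rintegrable (k (p w)) (fun y => Num.max (q (p w) - y) 0 / alpha).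
  by under eq_fun do rewrite mulrC; exact: rintegrableZ.
rewrite /f2 /= RintegralE; last first.
  by apply: rintegrableZ; apply: rintegrableD => //; exact: rintegrable_cst.
rewrite RintegralZl//; last by apply: rintegrableD => //; exact: rintegrable_cst.
rewrite RintegralD//; last exact: rintegrable_cst.
rewrite prob_Rintegral_cst RintegralZr// hw.
by congr EFin; field; exact: lt0r_neq0.
Qed.

(** If the mean were not positive, [g] would have mean zero, hence vanish almost surely under almost
    every conditional law. Then [e] must equal [e0], since otherwise [g] is positive everywhere, and
    [v] must equal [q], since otherwise [g] is positive on an interval of positive mass. This
    contradicts [distinct]. *)
Lemma loss_identification : 0 < \int[P]_w diff w.
Proof.
have ge w : f1 (p w, Y w) + f2 (p w, Y w) + g (p w, Y w) <= diff w.
  exact: loss_core_ge.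
(* The nonnegative [g] is bounded by [diff - f1 - f2], from which it inherits integrability. *)
have ig : rintegrable P (fun w => g (p w, Y w)).
  have i : rintegrable P (fun w => diff w - f1 (p w, Y w) - f2 (p w, Y w)).
    by apply: rintegrableB => //; exact: rintegrableB.
  apply: (rintegrable_le _ i).
    exact: (measurableT_comp mg (measurable_fun_pair mp mY)).
  by move=> w; rewrite ger0_norm//; have := ge w; lra.
have le_g : \int[P]_w g (p w, Y w) <= \int[P]_w diff w.
  have if2 : rintegrable P (fun w => f2 (p w, Y w)) by exact: iG2W.
  have -> : \int[P]_w g (p w, Y w) = \int[P]_w f1 (p w, Y w) +
      \int[P]_w f2 (p w, Y w) + \int[P]_w g (p w, Y w) by rewrite If1 If2 !add0r.
  rewrite -RintegralD// -RintegralD//; last exact: rintegrableD.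
  by apply: le_Rintegral => //; apply: rintegrableD => //; exact: rintegrableD.
rewrite ltNge; apply/negP => diff0; apply: distinct.
have g0 : (\int[P]_w (g (p w, Y w))%:E = 0)%E.
  rewrite RintegralE//; congr EFin; apply/eqP; rewrite eq_le (le_trans le_g)//=.
  by apply: Rintegral_ge0 => w _; exact: g_ge0.
have mgE : measurable_fun setT (EFin \o g) by exact/measurable_EFinP.
have g0' : (\int[P]_w \int[k (p w)]_y (g (p w, y))%:E = 0)%E.
  by rewrite -(ge0_disintegration mp mY mk kE mgE)// => z; rewrite lee_fin.
have ae0 : {ae P, forall w, (\int[k (p w)]_y (g (p w, y))%:E = 0)%E}.
  have h : ae_eq P setT (fun w => \int[k (p w)]_y (g (p w, y))%:E)%E (cst 0%E).
    apply/ae_eq_integral_abs => //; first exact: measurable_kernel_integral.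
    rewrite -[RHS]g0'; apply: eq_integral => w _; rewrite gee0_abs//.
    by apply: integral_ge0 => y _; rewrite lee_fin.
  by apply: filterS h => w; apply.
apply: filterS2 ae0 cond_pos => w gw pw.
have mgw : measurable_fun setT (fun y => (g (p w, y))%:E).
  by apply: (measurableT_comp mgE).
have [N [mN N0 sN]] : ae_eq (k (p w)) setT (fun y => (g (p w, y))%:E) (cst 0%E).
  apply/ae_eq_integral_abs => //; rewrite -[RHS]gw; apply: eq_integral => y _.
  by rewrite gee0_abs// lee_fin.
(* All points where [g] is positive lie in the null set [N]; each case below exhibits too many of
   them. *)
have gN y : 0 < g (p w, y) -> N y.
  move=> gy; apply: sN => /= /(_ I) [] gy0.
  by rewrite gy0 ltxx in gy.
have ep w' y : e (p w') != e0 (p w') -> 0 < g (p w', y).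
  move=> h; apply: ltr_wpDr; last exact: G2_tangent.
  rewrite divr_ge0//; last by case/andP: alpha01 => /ltW.
  by rewrite mulr_ge0 ?check_gap_ge0// ltW.
split; apply/eqP/negPn/negP => h; last first.
  have NT : N = setT by apply/seteqP; split => // y _; exact/gN/ep.
  have : (1%E = 0%E :> \bar R) by rewrite -(probability_setT (k (p w))) -NT.
  by move=> /eqP; rewrite onee_eq0.
have := pw _ h; rewrite ltNge => /negP; apply; rewrite -N0.
apply: le_measure; rewrite ?inE; [exact: measurable_itv|exact: mN|].
move=> y /=; rewrite in_itv/= => /andP[y1 y2]; apply: gN.
apply: ltr_wpDl.
  have [->|h'] := eqVneq (e (p w)) (e0 (p w)); last exact/ltW/G2_tangent.
  by rewrite subrr mulr0 sub0r addNr.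
rewrite divr_gt0//; last by case/andP: alpha01.
by rewrite mulr_gt0// check_gap_gt0.
Qed.

End Identification.

(** * Instantiation to the regression model *)

Section ContinuityOfLoss.
Context {R : realType}.

Lemma continuous_sumr (W : topologicalType) (I : Type) (s : seq I) (f : I -> W -> R) :
  (forall i, continuous (f i)) -> continuous (fun w => \sum_(i <- s) f i w).
Proof.
move=> cf; elim: s => [|i s ih] w.
  by under [fun _ => _]eq_fun do rewrite big_nil; exact: cvg_cst.
under [fun _ => _]eq_fun do rewrite big_cons.
by apply: (@continuousD _ _ _ (f i)); [exact: cf|exact: ih].
Qed.

Lemma continuous_dotr (W : topologicalType) k (x t : W -> 'rV[R]_k) :
  (forall j, continuous (fun w => x w 0 j)) ->
  (forall j, continuous (fun w => t w 0 j)) ->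
  continuous (fun w => dotr (x w) (t w)).
Proof.
move=> cx ct; apply: continuous_sumr => j w.
by apply: (@continuousM _ _ (fun w => x w 0 j) (fun w => t w 0 j)); [exact: cx|exact: ct].
Qed.

Lemma continuous_dotr_l k (t : 'rV[R]_k) : continuous (dotr^~ t).
Proof.
by apply: (@continuous_dotr _ _ id (fun=> t)) => j; [exact: coord_continuous|exact: cst_continuous].
Qed.

Lemma continuous_dotr_thq k (x : 'rV[R]_k) : continuous (fun th => dotr x (thq th)).
Proof.
apply: (@continuous_dotr _ _ (fun=> x) thq) => j; first exact: cst_continuous.
rewrite /thq (_ : (fun w => _) = fun w : 'rV[R]_(k + k) => w 0 (lshift k j)).
  exact: coord_continuous.
by apply/funext => u; rewrite mxE.
Qed.

Lemma continuous_dotr_the k (x : 'rV[R]_k) : continuous (fun th => dotr x (the th)).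
Proof.
apply: (@continuous_dotr _ _ (fun=> x) the) => j; first exact: cst_continuous.
rewrite /the (_ : (fun w => _) = fun w : 'rV[R]_(k + k) => w 0 (rshift k j)).
  exact: coord_continuous.
by apply/funext => u; rewrite mxE.
Qed.

Lemma continuous_loss_core (W : topologicalType) alpha (G1 G2 calG2 : R -> R) (y v e : W -> R) :
  continuous G1 -> continuous G2 -> continuous calG2 ->
  continuous y -> continuous v -> continuous e ->
  continuous (fun w => loss_core alpha G1 G2 calG2 (y w) (v w) (e w)).
Proof.
move=> c1 c2 c3 cy cv ce w; rewrite /loss_core.
have cc (G : R -> R) (u : W -> R) : continuous G -> continuous u -> G (u w') @[w' --> w] --> G (u w).
  by move=> cG cu; apply: (@continuous_comp _ _ _ u G); [exact: cu|exact: cG].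
have cmax : Num.max (v w') (y w') @[w' --> w] --> Num.max (v w) (y w).
  by apply: (@continuous_max _ _ v y); [exact: cv|exact: cy].
have cmax0 : Num.max (v w' - y w') 0 @[w' --> w] --> Num.max (v w - y w) 0.
  apply: (@continuous_max _ _ (fun w => v w - y w) (fun=> 0)); last exact: cvg_cst.
  by apply: cvgB; [exact: cv|exact: cy].
apply: cvgB; last exact: cc.
apply: cvgD.
  apply: cvgB; last by apply: cvgM; [exact: cvg_cst|exact: cc].
  by apply: (@continuous_comp _ _ _ (fun w => Num.max (v w) (y w)) G1); [exact: cmax|exact: c1].
apply: cvgM; first exact: cc.
apply: cvgD; first by apply: cvgB; [exact: ce|exact: cv].
by apply: cvgM; [exact: cmax0|exact: cvg_cst].
Qed.

Lemma continuous_abs_comp (W : topologicalType) (G : R -> R) (u : W -> R) :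
  continuous G -> continuous u -> continuous (fun w => `|G (u w)|).
Proof.
move=> cG cu w; apply: cvg_norm.
by apply: (@continuous_comp _ _ _ u G); [exact: cu|exact: cG].
Qed.

Lemma Cn_derivable n (f : R -> R) : Cn n.+1 f -> forall x, derivable f x 1.
Proof. by move=> [h _] x; exact: (h 0%N). Qed.

Lemma Cn_continuous n (f : R -> R) : Cn n.+1 f -> continuous f.
Proof.
move=> h x; apply/differentiable_continuous/derivable1_diffP; exact: Cn_derivable h x.
Qed.

Lemma compact_has_sup (W : topologicalType) (A : set W) (f : W -> R) :
  compact A -> A !=set0 -> continuous f -> has_sup [set f x | x in A].
Proof.
move=> cA [x Ax] cf; split; first by exists (f x), x.
have [M [_ hM]] := @compact_bounded R R _ (continuous_compact (continuous_subspaceT cf) cA).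
exists (M + 1) => y fy; apply: le_trans (ler_norm y) _.
by apply: (hM (M + 1)) => //; rewrite ltrDl.
Qed.

Lemma coord_norm_le k (x : 'rV[R]_k) j : `|x 0 j| <= `|x|.
Proof.
rewrite /Num.norm/= mx_normrE.
exact: (le_bigmax _ (fun ij : 'I_1 * 'I_k => `|x ij.1 ij.2|) (0, j)).
Qed.

(** The factor [k] counts the coordinates, each bounded through the maximum norm. *)
Lemma dotr_norm_le k (x t : 'rV[R]_k) M : (forall j, `|t 0 j| <= M) ->
  `|dotr x t| <= (k%:R * M) * `|x|.
Proof.
move=> h; apply: le_trans (ler_norm_sum _ _ _) _.
have -> : k%:R * M * `|x| = \sum_(j < k) (`|x| * M).
  by rewrite sumr_const card_ord -[RHS]mulr_natl; ring.
apply: ler_sum => j _; rewrite normrM ler_pM//; exact: coord_norm_le.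
Qed.

End ContinuityOfLoss.

(** * Conditioning on the sigma-algebra generated by X *)

Section SigmaX.
Context {d} {T : measurableType d} {R : realType} (P : probability T R).
Context {k : nat} (X : T -> 'rV[R]_k).
Hypothesis mX : measurable_fun setT (rv2t \o X).

(* Conditioning on [X] is disintegration over the sample space itself with the
   sub-sigma-algebra sigma(X), so that no factorisation through [X] is needed. *)
Definition sigmaX_type := g_sigma_algebraType (sigmaX X).

(** Preimages of measurable sets under one map are already a sigma-algebra, so generating adds
    nothing. *)
Lemma sigmaX_measurable (E : set sigmaX_type) : measurable E <-> sigmaX X E.
Proof.
have sE : sigmaX X = preimage_set_system setT (rv2t \o X) measurable.
  apply/seteqP; split => [_ [A [mA ->]]|_ [A mA <-]].
    by exists A => //; rewrite setTI.
  by exists A; rewrite setTI.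
rewrite -[measurable E]/(<<s sigmaX X >> E) sigma_algebra_id// sE.
exact/sigma_algebra_preimage/sigma_algebra_measurable.
Qed.

(** The identity onto the coarser sigma-algebra serves as the conditioning map [p] of the
    disintegration results. *)
Lemma measurable_to_sigmaX : measurable_fun setT (id : T -> sigmaX_type).
Proof.
move=> _ E /sigmaX_measurable[A [mA ->]].
by rewrite setTI; have := mX measurableT mA; rewrite setTI.
Qed.

Lemma measurable_coord_sigmaX j : measurable_fun setT (fun w : sigmaX_type => X w 0 j).
Proof.
move=> _ B mB; rewrite setTI; apply/sigmaX_measurable.
exists ((@tnth k R ^~ j) @^-1` B); split.
  by rewrite -[X in measurable X]setTI; exact: measurable_tnth.
by apply/seteqP; split => w /=; rewrite tnth_mktuple.
Qed.

Lemma measurable_dotr_sigmaX t : measurable_fun setT (fun w : sigmaX_type => dotr (X w) t).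
Proof.
apply: (@measurable_continuous_rV _ _ _ _ (X : sigmaX_type -> _) (dotr^~ t)).
  exact: measurable_coord_sigmaX.
exact: continuous_dotr_l.
Qed.

Lemma cond_law_kernel Z K : is_cond_law P X Z K ->
  forall B, measurable B -> measurable_fun setT (fun w : sigmaX_type => K (X w) B).
Proof.
move=> [h _] B mB.
have -> : (fun w : sigmaX_type => K (X w) B) = (fun w => (fine (K (X w) B))%:E).
  by apply/funext => w; rewrite fineK// fin_num_measure.
apply/measurable_EFinP => _ A mA; rewrite setTI; apply/sigmaX_measurable.
exact: h.
Qed.

Lemma cond_law_disintegrates Z K : is_cond_law P X Z K ->
  forall (A : set sigmaX_type) (B : set R), measurable A -> measurable B ->
  P ((id : T -> sigmaX_type) @^-1` A `&` Z @^-1` B) =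
  (\int[P]_(w in (id : T -> sigmaX_type) @^-1` A) K (X w) B)%E.
Proof. by move=> [_ h] A B /sigmaX_measurable sA mB; exact: h. Qed.

Hypothesis iX2 : P.-integrable setT (fun w => (`|X w| ^+ 2)%:E).

(** The quadratic form of E[XX'] at [v] is E[(X'v)^2]; it vanishes under the assumption, so
    definiteness forces v = 0. Finite second moments allow the sums to be exchanged with the
    integral. *)
Lemma ae_dotr0 (v : 'rV[R]_k) :
  (forall v : 'rV[R]_k, v != 0 -> 0 < \sum_(i < k) \sum_(j < k)
     v 0 i * v 0 j * fine (\int[P]_w (X w 0 i * X w 0 j)%:E)%E) ->
  {ae P, forall w, dotr (X w) v = 0} -> v = 0.
Proof.
move=> pd v0; apply/eqP/negPn/negP => /pd; rewrite lt_neqAle => /andP[/eqP + _]; apply.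
have mXj j : measurable_fun setT (fun w => X w 0 j).
  exact: (measurableT_comp (measurable_coord_sigmaX j) measurable_to_sigmaX).
have iXX i j : rintegrable P (fun w => X w 0 i * X w 0 j).
  apply: (rintegrable_le _ iX2); first exact: measurable_funM.
  by move=> w; rewrite normrM expr2 ler_pM// coord_norm_le.
have iw i j : rintegrable P (fun w => v 0 i * v 0 j * (X w 0 i * X w 0 j)).
  exact: rintegrableZ.
have -> : \sum_(i < k) \sum_(j < k) v 0 i * v 0 j * fine (\int[P]_w (X w 0 i * X w 0 j)%:E)%E
    = \int[P]_w (\sum_(i < k) \sum_(j < k) v 0 i * v 0 j * (X w 0 i * X w 0 j)).
  rewrite Rintegral_sum; last by move=> i; apply: rintegrable_sum => j.
  apply: eq_bigr => i _; rewrite Rintegral_sum//.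
  by apply: eq_bigr => j _; rewrite [RHS]RintegralZl//; exact: iXX.
have ei w : \sum_(i < k) \sum_(j < k) v 0 i * v 0 j * (X w 0 i * X w 0 j) = dotr (X w) v ^+ 2.
  rewrite expr2 /dotr mulr_suml; apply: eq_bigr => i _; rewrite mulr_sumr.
  by apply: eq_bigr => j _; ring.
under eq_Rintegral do rewrite ei.
rewrite /Rintegral (@ae_eq_integral _ _ _ P setT (cst 0%E)) ?integral0//.
  apply/measurable_EFinP/measurable_funX.
  exact: (measurableT_comp (measurable_dotr_sigmaX v) measurable_to_sigmaX).
by apply: filterS v0 => w h _; rewrite h expr0n.
Qed.

End SigmaX.

(** Zero expected shortfall of Y - c reads q - c = E[(q - Y)^+] / alpha: the quantile moves by [c],
    and the shift cancels inside the positive part. *)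
Lemma shifted_check_integral (R : realType) (mu nu : probability R R) (c alpha q : R) :
  (forall B, measurable B -> nu B = mu ((fun y : R => y - c) @^-1` B)) ->
  0 < alpha < 1 -> mu.-integrable setT EFin -> quantile alpha mu = q ->
  ES alpha nu = 0%E -> \int[mu]_y Num.max (q - y) 0 = alpha * (q - c).
Proof.
move=> nuE a01 imu qE; have a0 : alpha != 0 by case/andP: a01 => /lt0r_neq0.
rewrite ES_quantile//; last exact: integrable_shift nuE imu.
rewrite (quantile_shift nuE)// qE /Rintegral.
rewrite (ge0_integral_shift nuE (g := fun y => (Num.max (q - c - y) 0)%:E)); first last.
- by move=> y; rewrite lee_fin le_max lexx orbT.
- by apply/measurable_EFinP; apply: measurable_maxr => //; exact: measurable_funB.
rewrite (_ : integral mu setT (fun y => (fun z => (Num.max (q - c - z) 0)%:E) (y - c)) =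
    integral mu setT (fun y => (Num.max (q - y) 0)%:E)); last first.
  by apply: eq_integral => y _; rewrite opprB addrA subrK.
move=> [] h; set I := fine _ in h *.
have -> : I = alpha * (alpha^-1 * I) by rewrite mulrA divff// mul1r.
congr (_ * _); move: h; set J := _ * I; move=> h; rewrite -[J]add0r -h; ring.
Qed.

(** * Observations as tuples and as row vectors *)

Section Observation.
Context {R : realType} {k : nat}.

(** Tuples carry the product sigma-algebra and rows the topology; this map lets continuity of the
    loss in the observation yield measurability. *)
Definition obs_row (z : k.+1.-tuple R) : 'rV[R]_k.+1 := \row_i tnth z i.
Definition obs_y (u : 'rV[R]_k.+1) : R := u 0 ord0.
Definition obs_x (u : 'rV[R]_k.+1) : 'rV[R]_k := \row_j u 0 (lift ord0 j).

Lemma obs_y_yx2t y x : obs_y (obs_row (yx2t y x)) = y.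
Proof. by rewrite /obs_y mxE tnth_mktuple unlift_none. Qed.

Lemma obs_x_yx2t y x : obs_x (obs_row (yx2t y x)) = x.
Proof. by apply/rowP => j; rewrite !mxE tnth_mktuple liftK. Qed.

Lemma continuous_obs_y : continuous obs_y.
Proof. exact: coord_continuous. Qed.

Lemma continuous_dotr_obs_x t : continuous (fun u => dotr (obs_x u) t).
Proof.
apply: (@continuous_dotr _ _ _ obs_x (fun=> t)) => j; last exact: cst_continuous.
rewrite (_ : (fun w => _) = fun w : 'rV[R]_k.+1 => w 0 (lift ord0 j)).
  exact: coord_continuous.
by apply/funext => u; rewrite mxE.
Qed.

Lemma measurable_obs_row i : measurable_fun setT (fun z => obs_row z 0 i).
Proof.
rewrite (_ : (fun z => _) = (@tnth _ R ^~ i)); first exact: measurable_tnth.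
by apply/funext => z; rewrite mxE.
Qed.

Lemma measurable_yx2t d (T : measurableType d) (Y : T -> R) (X : T -> 'rV[R]_k) :
  measurable_fun setT Y -> measurable_fun setT (rv2t \o X) ->
  measurable_fun setT (fun w => yx2t (Y w) (X w)).
Proof.
move=> mY mX; apply/measurable_fun_tnthP => i.
rewrite (_ : _ \o _ = fun w => if unlift ord0 i is Some j then X w 0 j else Y w).
  case: (unlift ord0 i) => [j|//].
  rewrite (_ : (fun w => _) = (@tnth _ R ^~ j) \o (rv2t \o X)).
    by apply: measurableT_comp => //; exact: measurable_tnth.
  by apply/funext => w /=; rewrite tnth_mktuple.
by apply/funext => w /=; rewrite tnth_mktuple.
Qed.

End Observation.

Section SupTheta.
Context {R : realType} {k : nat} (Theta : set 'rV[R]_(k + k)).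
Variables (G : R -> R) (proj : 'rV[R]_(k + k) -> 'rV[R]_k).
Hypothesis cTheta : compact Theta.
Hypothesis Theta0 : Theta !=set0.
Hypothesis cG : continuous G.
Hypothesis cproj : forall x, continuous (fun th => dotr x (proj th)).

Let sup_G x := supTheta Theta (fun th => `|G (dotr x (proj th))|).

Lemma supTheta_has_sup x : has_sup [set `|G (dotr x (proj th))| | th in Theta].
Proof. by apply: compact_has_sup => //; apply: continuous_abs_comp. Qed.

Lemma supTheta_ge x th : Theta th -> `|G (dotr x (proj th))| <= sup_G x.
Proof.
by move=> Tth; apply: ub_le_sup; [exact: (supTheta_has_sup x).2|exists th].
Qed.

Lemma supTheta_ge0 x : 0 <= sup_G x.
Proof. by have [th Tth] := Theta0; apply: le_trans (supTheta_ge x Tth). Qed.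

Lemma measurable_supTheta d (S : measurableType d) (X : S -> 'rV[R]_k) :
  (forall j, measurable_fun setT (fun s => X s 0 j)) ->
  measurable_fun setT (fun s => sup_G (X s)).
Proof.
move=> mX; apply: (@measurable_sup_continuous _ _ _ _ X mX _ Theta
  (fun th x => `|G (dotr x (proj th))|)).
- by move=> th _; apply: continuous_abs_comp => //; exact: continuous_dotr_l.
- by move=> s; exact: supTheta_has_sup.
Qed.

End SupTheta.

(** * Consistency in the joint regression model *)

Unset Implicit Arguments.

Theorem theorem2
  (R : realType) (k : nat) (alpha : R)
  (d : measure_display) (Omega : measurableType d) (P : probability Omega R)
  (Y : Omega -> R) (X : Omega -> 'rV[R]_k)
  (Ys : nat -> Omega -> R) (Xs : nat -> Omega -> 'rV[R]_k)
  (Theta : set 'rV[R]_(k + k)) (theta0 : 'rV[R]_(k + k))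
  (Ky Kq Ke : 'rV[R]_k -> probability R R) (fY : 'rV[R]_k -> R -> R)
  (G1 G2 calG2 a : R -> R) :
  (* alpha in (0,1), complete probability space *)
  0 < alpha < 1 ->
  measure_is_complete P ->
  (* random variables *)
  measurable_fun setT Y -> measurable_fun setT (rv2t \o X) ->
  (forall i, measurable_fun setT (Ys i)) ->
  (forall i, measurable_fun setT (rv2t \o Xs i)) ->
  (* parameter space *)
  compact Theta -> interior Theta !=set0 -> Theta theta0 ->
  (* model (M): Y = X'th0q + uq = X'th0e + ue, Q_alpha(uq|X) = 0, ES_alpha(ue|X) = 0 *)
  is_cond_law P X (fun w => Y w - dotr (X w) (thq theta0)) Kq ->
  {ae P, forall w, quantile alpha (Kq (X w)) = 0} ->
  is_cond_law P X (fun w => Y w - dotr (X w) (the theta0)) Ke ->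
  {ae P, forall w, ES alpha (Ke (X w)) = 0%E} ->
  (* (A-1) *)
  iid_as P Ys Xs Y X ->
  is_cond_law P X Y Ky ->
  {ae P, forall w, (Ky (X w)).-integrable setT (fun y => (y ^+ 2)%:E)} ->
  {ae P, forall w, forall B, measurable B ->
     Ky (X w) B = (\int[lebesgue_measure]_(y in B) (fY (X w) y)%:E)%E} ->
  {ae P, forall w, exists2 eps : R, 0 < eps &
     let U := ball (dotr (X w) (thq theta0)) eps in
     (forall y, U y -> 0 < fY (X w) y) /\
     {within U, continuous (fY (X w))} /\
     (exists M : R, forall y, U y -> fY (X w) y <= M)} ->
  (* (A-2): E[XX'] positive definite *)
  (forall v : 'rV[R]_k, v != 0 ->
     0 < \sum_(i < k) \sum_(j < k)
           v 0 i * v 0 j * fine (\int[P]_w (X w 0 i * X w 0 j)%:E)%E) ->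
  (* (A-3) *)
  Cn 2 G1 -> {homo G1 : x y / x <= y} ->
  P.-integrable setT (fun w => (G1 (Y w))%:E) ->
  Cn 3 calG2 -> derive1 calG2 = G2 ->
  (forall x, 0 < G2 x) -> (forall x, 0 < derive1 G2 x) ->
  measurable_fun setT a -> P.-integrable setT (fun w => (a (Y w))%:E) ->
  (* moment conditions *)
  P.-integrable setT (fun w => (`|X w| ^+ 2)%:E) ->
  P.-integrable setT (fun w =>
     (supTheta Theta (fun th => `|G1 (dotr (X w) (thq th))|))%:E) ->
  P.-integrable setT (fun w => `|a (Y w)|%:E) ->
  P.-integrable setT (fun w =>
     (`|X w| * supTheta Theta (fun th => `|G2 (dotr (X w) (the th))|))%:E) ->
  P.-integrable setT (fun w =>
     ((supTheta Theta (fun th => `|G2 (dotr (X w) (the th))|))%:E *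
      \int[Ky (X w)]_y `|y|%:E)%E) ->
  P.-integrable setT (fun w =>
     (supTheta Theta (fun th => `|calG2 (dotr (X w) (the th))|))%:E) ->
  (* conclusion: every approximate minimiser is consistent *)
  forall thetahat : nat -> Omega -> 'rV[R]_(k + k),
  (forall n w, Theta (thetahat n w)) ->
  (forall eps : R, 0 < eps ->
     (fun n => outer_prob P [set w |
        (\sum_(i < n) rho_loss alpha G1 G2 calG2 a (Ys i w) (Xs i w) (thetahat n w)) / n%:R
        > (\sum_(i < n) rho_loss alpha G1 G2 calG2 a (Ys i w) (Xs i w) theta0) / n%:R + eps])
     @ \oo --> 0%E) ->
  forall eps : R, 0 < eps ->
    (fun n => outer_prob P [set w | `|thetahat n w - theta0| > eps]) @ \oo --> 0%E.
Proof.
move=> alpha01 _ mY mX mYs mXs cT _ T0 hKq qKq hKe eKe [iid1 iid2] hKy sq2 dens posd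
  pd C1 G1nd iG1 C3 dG2 G2pos dG2pos _ _ iX2 iS1 _ iS2X iS2Y iS3 thetahat hatT approx
  eps eps0.
have /andP[a0 a1] := alpha01.
have cG1 : continuous G1 by apply: (Cn_continuous C1).
have cC : continuous calG2 by apply: (Cn_continuous C3).
have drvG2 x : derivable G2 x 1 by rewrite -dG2; exact: (C3.1 1%N isT x).
have cG2 : continuous G2.
  by move=> x; apply/differentiable_continuous/derivable1_diffP.
have tangent := strictly_convex_tangent (Cn_derivable C3) drvG2 dG2 dG2pos.
have TN0 : Theta !=set0 by exists theta0.
have mG1 := continuous_measurable_fun cG1.
have mG2 := continuous_measurable_fun cG2.
have mC := continuous_measurable_fun cC.
pose S1 x := supTheta Theta (fun th => `|G1 (dotr x (thq th))|).
pose S2 x := supTheta Theta (fun th => `|G2 (dotr x (the th))|).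
pose S3 x := supTheta Theta (fun th => `|calG2 (dotr x (the th))|).
have S1le x th : Theta th -> `|G1 (dotr x (thq th))| <= S1 x.
  by move=> Tth; apply: (@supTheta_ge _ _ Theta G1 thq) => // y; exact: continuous_dotr_thq.
have S2le x th : Theta th -> `|G2 (dotr x (the th))| <= S2 x.
  by move=> Tth; apply: (@supTheta_ge _ _ Theta G2 the) => // y; exact: continuous_dotr_the.
have S3le x th : Theta th -> `|calG2 (dotr x (the th))| <= S3 x.
  by move=> Tth; apply: (@supTheta_ge _ _ Theta calG2 the) => // y; exact: continuous_dotr_the.
have S2_ge0 x : 0 <= S2 x.
  by apply: (@supTheta_ge0 _ _ Theta G2 the) => // y; exact: continuous_dotr_the.
(* [Theta] is bounded, so one constant bounds both linear forms over all of [Theta]; adding 1 to |M|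
   gives a radius strictly above [M]. *)
have [C C0 Cle] : exists2 C : R, 0 <= C & forall x th, Theta th ->
    `|dotr x (thq th)| <= C * `|x| /\ `|dotr x (the th)| <= C * `|x|.
  have [M [_ hM]] := compact_bounded cT.
  have hM' th : Theta th -> `|th| <= `|M| + 1.
    by move=> Tth; apply: (hM (`|M| + 1)) => //; rewrite (le_lt_trans (ler_norm M))// ltrDl.
  exists (k%:R * (`|M| + 1)); first by rewrite mulr_ge0// addr_ge0.
  move=> x th Tth; split; apply: dotr_norm_le => j.
    by rewrite mxE; apply: le_trans (coord_norm_le _ _) (hM' _ Tth).
  by rewrite mxE; apply: le_trans (coord_norm_le _ _) (hM' _ Tth).
have core_le y x th : Theta th ->
    `|loss_core alpha G1 G2 calG2 y (dotr x (thq th)) (dotr x (the th))| <=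
    2 * S1 x + `|G1 y| + S2 x * (C * `|x| + C * `|x| + (C * `|x| + `|y|) / alpha) + S3 x.
  move=> Tth; have [c1 c2] := Cle x th Tth.
  apply: le_trans (loss_core_norm_le _ _ _ alpha01 _ _ _) _.
  apply: lerD (S3le _ _ Tth); apply: lerD.
    by rewrite lerD2r ler_pM2l ?S1le.
  apply: ler_pM => //; first by rewrite !addr_ge0 ?divr_ge0 ?addr_ge0// ltW.
    exact: S2le.
  by rewrite !lerD// ler_pM2r ?invr_gt0// lerD2r.
have mp := measurable_to_sigmaX mX.
have mXc j : measurable_fun setT (fun w => X w 0 j).
  exact: (measurableT_comp (measurable_coord_sigmaX (X := X) j) mp).
have mS2 : measurable_fun setT (fun s : sigmaX_type X => S2 (X s)).
  apply: (@measurable_supTheta _ _ Theta G2 the) => //.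
    by move=> y; exact: continuous_dotr_the.
  exact: measurable_coord_sigmaX.
have mky := cond_law_kernel hKy.
have kyE := cond_law_disintegrates hKy.
(* The moment condition contains the conditional mean of |Y|; disintegration turns it into
   integrability of the product with |Y| itself. *)
have iS2aY : rintegrable P (fun w => S2 (X w) * `|Y w|).
  pose F (z : sigmaX_type X * R) := (S2 (X z.1) * `|z.2|)%:E.
  have mF : measurable_fun setT F.
    apply/measurable_EFinP/measurable_funM; first exact: (measurableT_comp mS2).
    exact: measurableT_comp.
  apply/integrableP; split.
    exact: (measurableT_comp mF (measurable_fun_pair mp mY)).
  have F0 z : (0 <= F z)%E by rewrite lee_fin mulr_ge0.
  have -> : (\int[P]_w `|(EFin \o (fun w => S2 (X w) * `|Y w|)%R) w|)%E =
      (\int[P]_w F (w, Y w))%E.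
    by apply: eq_integral => w _; rewrite gee0_abs//; exact: (F0 (w, Y w)).
  rewrite (ge0_disintegration mp mY mky kyE mF F0).
  have /integrableP[_] := iS2Y; apply: le_lt_trans; rewrite le_eqVlt; apply/orP; left.
  apply/eqP; apply: eq_integral => w _; rewrite gee0_abs; last first.
    by rewrite mule_ge0 ?lee_fin ?S2_ge0// integral_ge0.
  rewrite -ge0_integralZl//; last exact: S2_ge0.
  by apply/measurable_EFinP; exact: normr_measurable.
pose Zs i w := yx2t (Ys i w) (Xs i w).
pose Z w := yx2t (Y w) (X w).
have mZs i : measurable_fun setT (Zs i) by exact: measurable_yx2t.
have mZ : measurable_fun setT Z by exact: measurable_yx2t.
have indep i j A B : i != j -> measurable A -> measurable B ->
    P (Zs i @^-1` A `&` Zs j @^-1` B) = (P (Zs i @^-1` A) * P (Zs j @^-1` B))%E.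
  move=> ij mA mB.
  have := iid2 [:: i; j] (fun l => if l == i then A else B).
  rewrite /= inE ij => /(_ isT); rewrite !big_cons !big_nil setIT mule1 eqxx.
  rewrite eq_sym (negPf ij); apply.
  by move=> l; case: ifP.
pose core (u : 'rV[R]_k.+1) (th : 'rV[R]_(k + k)) := loss_core alpha G1 G2 calG2 (obs_y u)
  (dotr (obs_x u) (thq th)) (dotr (obs_x u) (the th)).
(* This is the excess loss over [theta0]: the terms [- G1 y + a y] cancel. *)
pose ell (z : k.+1.-tuple R) th := core (obs_row z) th - core (obs_row z) theta0.
pose bnd y x := 2 * S1 x + `|G1 y| +
  S2 x * (C * `|x| + C * `|x| + (C * `|x| + `|y|) / alpha) + S3 x.
(* One [bnd] for the parameter and one for [theta0]. *)
pose env (z : k.+1.-tuple R) := 2 * bnd (obs_y (obs_row z)) (obs_x (obs_row z)).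
have ell_env z th : Theta th -> `|ell z th| <= env z.
  move=> Tth; apply: le_trans (ler_normB _ _) _.
  by rewrite /env mulr_natl mulr2n lerD// /bnd; exact: core_le.
(* Regrouped, the bound is a linear combination of the variables in the moment conditions. *)
have ibnd : rintegrable P (fun w => bnd (Y w) (X w)).
  rewrite /bnd (_ : (fun w => _) = fun w => 2 * S1 (X w) + `|G1 (Y w)| +
      ((C + C + C / alpha) * (`|X w| * S2 (X w)) + alpha^-1 * (S2 (X w) * `|Y w|)) +
      S3 (X w)); last by apply/funext => w; ring.
  apply: rintegrableD => //; apply: rintegrableD.
    by apply: rintegrableD; [exact: rintegrableZ|exact: rintegrable_norm].
  by apply: rintegrableD; exact: rintegrableZ.
have ienv : rintegrable P (env \o Z).
  rewrite /env /Z /comp; under eq_fun do rewrite obs_y_yx2t obs_x_yx2t.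
  exact: rintegrableZ.
have ccore th : continuous (fun u => core u th).
  apply: continuous_loss_core => //; first exact: continuous_obs_y.
    exact: continuous_dotr_obs_x.
  exact: continuous_dotr_obs_x.
have cell z : continuous (ell z).
  move=> th.
  have h : continuous (core (obs_row z)).
    apply: continuous_loss_core => //; first exact: cst_continuous.
      exact: continuous_dotr_thq.
    exact: continuous_dotr_the.
  exact: (cvgB (h th) (cvg_cst (core (obs_row z) theta0))).
have cellu th : continuous (fun u => core u th - core u theta0).
  by move=> u; exact: (cvgB (ccore th u) (ccore theta0 u)).
have mell th : measurable_fun setT (ell^~ th).
  exact: (measurable_continuous_rV (@measurable_obs_row R k) (cellu th)).
have minf th r : Theta th -> 0 < r ->
    measurable_fun setT (fun z => inf [set ell z t | t in Theta `&` ball th r]).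
  move=> Tth r0.
  apply: (@measurable_inf_continuous _ _ _ _ obs_row (@measurable_obs_row R k) _
    (Theta `&` ball th r) (fun t u => core u t - core u theta0)).
    by move=> t _; exact: cellu.
  move=> z; split; first by exists (ell z th), th => //; split => //; exact: ballxx.
  exists (- env z) => _ [t [Tt _] <-].
  by have := ell_env z t Tt; rewrite ler_norml => /andP[].
(* From here on [Kq] and [Ke] are translates of [Ky], so their quantile and expected shortfall
   become those of [Y] given [X]. *)
have linkq := ae_shifted_law mp mY (measurable_dotr_sigmaX (X := X) (thq theta0)) mky
  (cond_law_kernel hKq) kyE (cond_law_disintegrates hKq).
have linke := ae_shifted_law mp mY (measurable_dotr_sigmaX (X := X) (the theta0)) mky
  (cond_law_kernel hKe) kyE (cond_law_disintegrates hKe).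
have cint : {ae P, forall w, (Ky (X w)).-integrable setT EFin}.
  by apply: filterS sq2 => w; exact: prob_square_integrable.
have quantE : {ae P, forall w, quantile alpha (Ky (X w)) = dotr (X w) (thq theta0)}.
  apply: filterS2 linkq qKq => w qw.
  by rewrite (quantile_shift qw alpha01) => /eqP; rewrite subr_eq0 => /eqP.
have cquant : {ae P, forall w, dfun (Ky (X w)) (dotr (X w) (thq theta0)) = alpha}.
  by apply: filterS2 quantE dens => w qE dE; exact: (dfun_quantile_density dE alpha01 qE).
have cES : {ae P, forall w,
    \int[Ky (X w)]_y Num.max (dotr (X w) (thq theta0) - y) 0 =
    alpha * (dotr (X w) (thq theta0) - dotr (X w) (the theta0))}.
  apply: filterS2 (filterI linke eKe) (filterI cint quantE) => w [le we] [iw qE].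
  exact: (shifted_check_integral le).
have cpos : {ae P, forall w, forall x, x != dotr (X w) (thq theta0) ->
    (0 < Ky (X w) `]Num.min (dotr (X w) (thq theta0)) x,
                    Num.max (dotr (X w) (thq theta0)) x[%classic)%E}.
  apply: filterS2 dens posd => w dE [r r0 [f0 [cf _]]] x xq.
  exact: (prob_between_gt0 dE r0 f0 cf).
have ell_gt0 th : Theta th -> th != theta0 -> 0 < \int[P]_w ell (Z w) th.
  move=> Tth thn.
  have mdot t := measurable_dotr_sigmaX (X := X) t.
  have mcomp (G : R -> R) t : measurable_fun setT G ->
      measurable_fun setT (fun w => G (dotr (X w) t)).
    by move=> mG; exact: (measurableT_comp mG (measurableT_comp (mdot t) mp)).
  have mdX t : measurable_fun setT (fun w => dotr (X w) t).
    exact: (measurableT_comp (mdot t) mp).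
  have ellE w : ell (Z w) th =
      loss_core alpha G1 G2 calG2 (Y w) (dotr (X w) (thq th)) (dotr (X w) (the th)) -
      loss_core alpha G1 G2 calG2 (Y w) (dotr (X w) (thq theta0)) (dotr (X w) (the theta0)).
    by rewrite /ell /core obs_y_yx2t obs_x_yx2t.
  under eq_Rintegral do rewrite ellE.
  apply: (@loss_identification _ _ _ P _ (sigmaX_type X) id Y (fun s => Ky (X s)) mp mY
    mky kyE alpha G1 G2 calG2 (fun s => dotr (X s) (thq th)) (fun s => dotr (X s) (the th))
    (fun s => dotr (X s) (thq theta0)) (fun s => dotr (X s) (the theta0))) => //.
  - apply: (rintegrable_le (mcomp _ _ mG1) iS1) => w; exact: S1le.
  - apply: (rintegrable_le (mcomp _ _ mG1) iS1) => w; exact: S1le.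
  - apply: (rintegrable_le _ (rintegrableZ (C + C) iS2X)) => [|w].
      by apply: measurable_funM; [exact: mcomp|exact: measurable_funB].
    have -> : (C + C) * (`|X w| * S2 (X w)) = S2 (X w) * (C * `|X w| + C * `|X w|) by ring.
    rewrite normrM; apply: ler_pM => //; first exact: S2le.
    have [c1 _] := Cle (X w) th Tth; have [c2 _] := Cle (X w) theta0 T0.
    by apply: le_trans (ler_normB _ _) _; exact: lerD.
  (* The two values of [G2] contribute at most 2 S2(X), and the other factor grows at most linearly
     in |X| and |Y|. *)
  - have i : rintegrable P (fun w => 2 * ((C + C + C / alpha) * (`|X w| * S2 (X w)) +
        alpha^-1 * (S2 (X w) * `|Y w|))).
      by apply: rintegrableZ; apply: rintegrableD; exact: rintegrableZ.
    apply: (rintegrable_le _ i) => [|w].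
      apply: measurable_funM; first by apply: measurable_funB; exact: mcomp.
      apply: measurable_funD; first exact: measurable_funB.
      apply: measurable_funM => //; apply: measurable_maxr => //.
      exact: measurable_funB.
    have [c1 c2] := Cle (X w) theta0 T0.
    have -> : 2 * ((C + C + C / alpha) * (`|X w| * S2 (X w)) +
        alpha^-1 * (S2 (X w) * `|Y w|)) = (S2 (X w) + S2 (X w)) *
        (C * `|X w| + C * `|X w| + (C * `|X w| + `|Y w|) / alpha) by ring.
    rewrite normrM; apply: ler_pM => //.
      by apply: le_trans (ler_normB _ _) _; apply: lerD; exact: S2le.
    apply: le_trans (ler_normD _ _) _; apply: lerD.
      by apply: le_trans (ler_normB _ _) _; apply: lerD.
    rewrite normrM [X in _ * X]gtr0_norm ?invr_gt0// ler_pM2r ?invr_gt0//.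
    rewrite maxEle; case: ifPn => _.
      by rewrite normr0 addr_ge0// mulr_ge0.
    by apply: le_trans (ler_normB _ _) _; apply: lerD.
  - have := rintegrable_le (measurableT_comp (mell th) mZ) ienv
      (fun w => ell_env (Z w) th Tth).
    by rewrite /comp; under eq_fun do rewrite ellE.
  (* If the linear forms agreed almost surely, both halves of [th - theta0] would be orthogonal to
     [X] almost surely, hence zero. *)
  - move=> aeq; have dotrB x u v : dotr x (u - v) = dotr x u - dotr x v :> R.
      by rewrite /dotr -sumrB; apply: eq_bigr => j _; rewrite !mxE mulrBr.
    have eq0q : thq th - thq theta0 = 0.
      apply: (ae_dotr0 mX iX2 pd); apply: filterS aeq => w [h _].
      by rewrite dotrB h subrr.
    have eq0e : the th - the theta0 = 0.
      apply: (ae_dotr0 mX iX2 pd); apply: filterS aeq => w [_ h].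
      by rewrite dotrB h subrr.
    move/eqP: thn; apply; rewrite -[th]hsubmxK -[theta0]hsubmxK; congr row_mx.
      exact: (subr0_eq eq0q).
    exact: (subr0_eq eq0e).
have approx' c : 0 < c -> (fun n => outer_prob P
    [set w | (\sum_(i < n) ell (Zs i w) (thetahat n w)) / n%:R > c]) @ \oo --> 0%E.
  move=> c0; have := approx c c0.
  rewrite (_ : (fun n => _) = fun n => outer_prob P
    [set w | (\sum_(i < n) ell (Zs i w) (thetahat n w)) / n%:R > c])//.
  apply/funext => n; congr (outer_prob P _).
  (* For every sample the average of [ell] is exactly the difference of the averaged losses, so the
     two events coincide. *)
  have E w : (\sum_(i < n) ell (Zs i w) (thetahat n w)) / n%:R =
      (\sum_(i < n) rho_loss alpha G1 G2 calG2 a (Ys i w) (Xs i w) (thetahat n w)) / n%:R -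
      (\sum_(i < n) rho_loss alpha G1 G2 calG2 a (Ys i w) (Xs i w) theta0) / n%:R.
    rewrite -mulrBl -sumrB; congr (_ / _); apply: eq_bigr => i _.
    by rewrite !rho_lossE /ell /core obs_y_yx2t obs_x_yx2t; ring.
  by apply/seteqP; split => w /=; rewrite E ltrBrDl.
have /outer_prob_cvg0P H := wald_consistency mZs mZ iid1 indep cT cell mell minf
  ell_env ienv ell_gt0 hatT approx' eps0.
apply/outer_prob_cvg0P => e e_gt0; apply: filterS (H e e_gt0) => n; apply: le_trans.
apply: outer_prob_le => w /= h; rewrite -ball_normE /= distrC => h'.
by have := lt_trans h h'; rewrite ltxx.
Qed.
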